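(* Any homogeneous Hamiltonian stationary Lagrangian torus in $\mathbb{C}P^2$ is, up to $U(3)$ congruence, the image by the Hopf map $\pi$ of some Cartesian product $$r_1S^1\times r_2S^1\times r_3S^1=\{z=(z^1,z^2,z^3)\in\mathbb{C}^3:\ |z^1|=r_1,\ |z^2|=r_2,\ |z^3|=r_3\},$$ where $r_1,r_2,r_3>0$ and $r_1^2+r_2^2+r_3^2=1$. Moreover, the torus is special Lagrangian if and only if $r_1=r_2=r_3=1/\sqrt{3}$.
   Context: $\pi:S^5\subset\mathbb{C}^3\to\mathbb{C}P^2=S^5/S^1$ is the Hopf fibration; $\mathbb{C}P^2$ carries the Fubini-Study Hermitian metric (so that $d\pi_z$ is an isometry from the Hermitian orthogonal of $z$ in $\mathbb{C}^3$ onto $T_{\pi(z)}\mathbb{C}P^2$), with Kähler form $\omega$; $U(3)$ acts isometrically on $\mathbb{C}P^2$. A homogeneous torus is an immersion $u:S^1\times S^1\to\mathbb{C}P^2$ for which there are skew-Hermitian $3\times3$ matrices $A,B$ with $u(x+t,y)=e^{tA}u(x,y)$ and $u(x,y+t)=e^{tB}u(x,y)$ for all $x,y,t$. It is Lagrangian if $u^*\omega=0$. Locally (or on the universal cover) a Lagrangian immersion $u$ has a Legendrian lift $\widehat{u}$ to $S^5$, i.e. $\pi\circ\widehat{u}=u$ and $\langle d\widehat{u},\widehat{u}\rangle_{\mathbb{C}^3}=0$ (Hermitian product), unique up to a constant unit complex factor; its Lagrangian angle $\beta$ is defined by $e^{i\beta}=\det(\widehat{u},d\widehat{u}(e_1),d\widehat{u}(e_2))$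 for any oriented local orthonormal tangent frame $(e_1,e_2)$ for the induced metric, so $\beta$ is locally defined up to an additive constant. $u$ is Hamiltonian stationary if it is a critical point of the area under Hamiltonian variations; equivalently, $\beta$ is locally harmonic for the induced metric. The torus is special Lagrangian if $\beta$ is locally constant, equivalently if $u$ is minimal. *)

(* Defs.v *)
From HB Require Import structures.
From mathcomp Require Import all_boot all_order all_algebra.
From mathcomp Require Import complex.
From mathcomp Require Import all_classical all_reals all_analysis.

Set Implicit Arguments.
Unset Strict Implicit.
Unset Printing Implicit Defensive.

Import Order.TTheory GRing.Theory Num.Theory.
Import numFieldNormedType.Exports.

Local Open Scope classical_set_scope.
Local Open Scope ring_scope.
Local Open Scope complex_scope.
Local Open Scope sesquilinear_scope.

Section HermitianSpace.
Context {R : realType}.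
Implicit Types z w : 'cV[R[i]]_3.

Definition herm z w : R[i] := \sum_k z k 0 * (w k 0)^*.

Definition S5 : set 'cV[R[i]]_3 := [set z | herm z z = 1].

(* A point of CP^2 = S^5/S^1 is the S^1-orbit of a point of S^5; a map into
   CP^2 is a map into [set 'cV[R[i]]_3] whose values are such orbits, which
   is enforced below by the existence of lifts to S^5. *)
Definition hopf z : set 'cV[R[i]]_3 :=
  [set w | exists2 c : R[i], `|c| = 1 & w = c *: z].

Definition act (M : 'M[R[i]]_3) (P : set 'cV[R[i]]_3) : set 'cV[R[i]]_3 :=
  [set M *m z | z in P].

Definition skew_hermitian (M : 'M[R[i]]_3) : Prop := M ^t* = - M.

(* The exponential series, summed entrywise on real and imaginary parts. *)
Definition expmx (n : nat) (M : 'M[R[i]]_n.+1) : 'M[R[i]]_n.+1 :=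
  let psum (N : nat) := \sum_(k < N) (k`!%:R)^-1 *: M ^+ k in
  \matrix_(i, j) (limn (fun N => complex.Re (psum N i j))
                   +i* limn (fun N => complex.Im (psum N i j))).

Definition hproj z w : 'cV[R[i]]_3 := w - herm w z *: z.

(* The complex structure of C^3 is z |-> 'i *: z, and omega (X, Y) = g (J X, Y). *)
Definition kahler z w : R := complex.Re (herm ('i *: z) w).

Definition det3 z1 z2 z3 : R[i] :=
  \det (\matrix_(i < 3, j < 3) ([:: z1; z2; z3]`_j) i 0).

Definition torus3 (r : 'I_3 -> R) : set 'cV[R[i]]_3 :=
  [set z | forall k, `|z k 0| = (r k)%:C].

End HermitianSpace.

Section Smoothness.
Context {R : realType} {V : normedModType R}.

Fixpoint Ck (n : nat) (W : set V) (f : V -> R) : Prop :=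
  (forall p, W p -> {for p, continuous f}) /\
  (if n is n'.+1 then
     forall v, (forall p, W p -> derivable f p v) /\ Ck n' W ('D_v f)
   else True).

Definition smooth (W : set V) (f : V -> R) : Prop := forall n, Ck n W f.

(* R[i] is a normed space over itself, not over R, so that calculus for
   C^3-valued maps goes through real and imaginary parts. *)
Definition smoothC (W : set V) (F : V -> 'cV[R[i]]_3) : Prop :=
  forall k, smooth W (fun q => complex.Re (F q k 0)) /\
            smooth W (fun q => complex.Im (F q k 0)).

Definition deriveC (F : V -> 'cV[R[i]]_3) (p v : V) : 'cV[R[i]]_3 :=
  \col_k ('D_v (fun q => complex.Re (F q k 0)) p
           +i* 'D_v (fun q => complex.Im (F q k 0)) p).

Implicit Types (u : V -> set 'cV[R[i]]_3) (F : V -> 'cV[R[i]]_3).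

Definition local_lift u (p : V) F : Prop :=
  exists2 W : set V, open_nbhs p W &
    smoothC W F /\ forall q, W q -> S5 (F q) /\ hopf (F q) = u q.

(* As pi is a submersion, a map into CP^2 is smooth iff it locally factors
   through smooth maps to S^5. *)
Definition smooth_map u : Prop := forall p, exists F, local_lift u p F.

(* T_{pi(z)} CP^2 is identified through d(pi)_z with the Hermitian orthogonal
   of z: for a local lift F of u at p, this vector represents du_p(v). *)
Definition tangent F (p v : V) : 'cV[R[i]]_3 := hproj (F p) (deriveC F p v).

Definition metric F (p v w : V) : R :=
  complex.Re (herm (tangent F p v) (tangent F p w)).

End Smoothness.

Section Tori.
Context {R : realType}.
Implicit Types u : R * R -> set 'cV[R[i]]_3.

(* Maps on S^1 x S^1 = (R / 2 pi Z)^2 are doubly periodic maps on R^2. *)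
Definition doubly_periodic (T : Type) (f : R * R -> T) : Prop :=
  forall x y, f (x + 2 * pi, y) = f (x, y) /\ f (x, y + 2 * pi) = f (x, y).

Definition immersion u : Prop :=
  smooth_map u /\
  forall p F, local_lift u p F -> forall v, tangent F p v = 0 -> v = 0.

Definition homogeneous_torus u : Prop :=
  [/\ doubly_periodic u, immersion u &
      exists A B : 'M[R[i]]_3, [/\ skew_hermitian A, skew_hermitian B &
        forall x y t, u (x + t, y) = act (expmx (t%:C *: A)) (u (x, y)) /\
                      u (x, y + t) = act (expmx (t%:C *: B)) (u (x, y))]].

Definition lagrangian u : Prop :=
  forall p F, local_lift u p F ->
  forall v w, kahler (tangent F p v) (tangent F p w) = 0.

(* The value does not depend on the chosen lift. *)
Definition area_density u (p : R * R) : R :=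
  get [set a | exists2 F, local_lift u p F &
    a = Num.sqrt (metric F p (1, 0) (1, 0) * metric F p (0, 1) (0, 1)
                   - metric F p (1, 0) (0, 1) ^+ 2)].

Definition area u : R :=
  \int[(lebesgue_measure \x lebesgue_measure)%E]_(p in
    `[0, 2 * pi] `*` `[0, 2 * pi]) area_density u p.

(* A smooth one-parameter family of tori through u whose variation field V at
   s = 0 is Hamiltonian: u^*(omega (V, .)) = dh with h a function on the
   torus. *)
Definition hamiltonian_variation u (U : R -> R * R -> set 'cV[R[i]]_3) : Prop :=
  let Ut (q : R * (R * R)) := U q.1 q.2 in
  [/\ smooth_map Ut,
      (forall s, doubly_periodic (U s)),
      U 0 = u &
      exists h : R * R -> R, [/\ smooth setT h, doubly_periodic h &
        forall p F, local_lift Ut (0, p) F -> forall e : R * R,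
          kahler (tangent F (0, p) (1, 0)) (tangent F (0, p) (0, e))
            = 'D_e h p]].

Definition hamiltonian_stationary u : Prop :=
  forall U, hamiltonian_variation u U ->
    is_derive (0 : R) (1 : R) (fun s => area (U s)) 0.

Definition legendrian_lift u (p : R * R) (F : R * R -> 'cV[R[i]]_3) : Prop :=
  local_lift u p F /\
  \forall q \near p, forall v, herm (deriveC F q v) (F q) = 0.

(* Orientation: the standard one of S^1 x S^1. *)
Definition oriented_orthonormal (F : R * R -> 'cV[R[i]]_3) (p e1 e2 : R * R)
    : Prop :=
  [/\ metric F p e1 e1 = 1, metric F p e2 e2 = 1, metric F p e1 e2 = 0 &
      0 < e1.1 * e2.2 - e1.2 * e2.1].

Definition lagrangian_angle u (p : R * R) (beta : R * R -> R) : Prop :=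
  exists2 F, legendrian_lift u p F &
  \forall q \near p, {for q, continuous beta} /\
    forall e1 e2, oriented_orthonormal F q e1 e2 ->
      cos (beta q) +i* sin (beta q)
        = det3 (F q) (deriveC F q e1) (deriveC F q e2).

Definition special_lagrangian u : Prop :=
  forall p, exists2 beta, lagrangian_angle u p beta &
    \forall q \near p, beta q = beta p.

End Tori.

(* Main.v *)
Require Import Defs.
From HB Require Import structures.
From mathcomp Require Import all_boot all_order all_algebra.
From mathcomp Require Import complex.
From mathcomp Require Import all_classical all_reals all_analysis.
From mathcomp Require Import ring lra.
Import Order.TTheory GRing.Theory Num.Theory.
Import numFieldNormedType.Exports.

Set Implicit Arguments.
Unset Strict Implicit.
Unset Printing Implicit Defensive.

Local Open Scope classical_set_scope.
Local Open Scope complex_scope.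
Local Open Scope ring_scope.
Local Open Scope sesquilinear_scope.

(** A homogeneous torus is an orbit [u (x, y) = e^{xA} e^{yB} u (0, 0)], and
    everything reduces to linear algebra once [A] and [B] are known to commute.

    Commutation.  Let [z0] lie over [u (0, 0)].  The vectors [z0], [A z0] and
    [B z0] form a complex basis of C^3: as [u] is an immersion, the horizontal
    parts of the last two are independent over the reals, and as their Hermitian
    product is real by the Lagrangian condition, they are independent over the
    complex numbers ([det3_neq0], [orbit_frame]).  Along the torus the two flows
    commute up to a phase; differentiating once in each direction, the commutator
    [C = AB - BA] maps each vector over a point of the torus to a multiple of
    itself ([commutator_line]).  Differentiating this eigenvector equation along
    the torus, the eigenvalue stays constant because [C] is skew-Hermitian, so
    that [A z0] and [B z0] are eigenvectors of [C] for the eigenvalue of [z0]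
    ([commutator_tangent]).  Hence [C] is scalar, and being trace free it
    vanishes ([homogeneous_commute]).

    Normal form.  In a unitary basis that diagonalizes [A] and [B]
    ([skew_codiag]) the torus lifts to
    [z_k = e^{i (a_k x + b_k y)} zeta_k].  Subtracting from [a] and [b] their
    means with weights [|zeta_k|^2] multiplies the lift by a phase, so both
    weighted means may be taken to be 0 ([homogeneous_normal_form]).  That
    [z0], [A z0], [B z0] is a basis says that no [zeta_k] vanishes and
    that [(1, 1, 1)], [a] and [b] span R^3; so up to a common phase the orbit
    reaches all the arguments of the coordinates, and it covers the whole product
    of circles of radii [r_k = |zeta_k|] ([normal_form_range]).

    Lagrangian angle.  The centering of [a] and [b] makes the lift Legendrian,
    and its angle satisfies [e^{i beta} = c e^{i (x sum_k a_k + y sum_k b_k)}]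
    with a constant [c] ([det3_L]); any other Legendrian lift differs from this
    one by a locally constant phase.  So the torus is special Lagrangian exactly
    when [sum_k a_k = sum_k b_k = 0] ([special_of_balanced],
    [balanced_of_special]).  Together with the centering, these equations say
    that [r_k^2 - 1/3] is orthogonal to [a] and [b]; it is also orthogonal to
    [(1, 1, 1)], so it vanishes ([special_lagrangian_iff]). *)

(** * Unit complex numbers *)

Section Cis.
Context {R : realType}.
Implicit Types (t : R) (c : R[i]).

Definition cis t : R[i] := cos t +i* sin t.

Lemma cis0 : cis 0 = 1.
Proof. by rewrite /cis cos0 sin0. Qed.

Lemma cisD s t : cis (s + t) = cis s * cis t.
Proof.
rewrite /cis cosD sinD; apply/eqP; rewrite eq_complex /= eqxx /=.
by rewrite addrC [sin s * _]mulrC [X in X + _]mulrC mulrC addrC eqxx.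
Qed.

Lemma conj_cis t : (cis t)^* = cis (- t).
Proof. by rewrite /cis cosN sinN. Qed.

Lemma cis_conj t : cis t * (cis t)^* = 1.
Proof. by rewrite conj_cis -cisD subrr cis0. Qed.

Lemma normC1 c : `|c| = 1 <-> c * c^* = 1.
Proof.
have -> : c * c^* = `|c| ^+ 2 by rewrite sqr_normc.
split=> [->|/eqP]; first by rewrite expr1n.
by rewrite sqrp_eq1 ?normr_ge0// => /eqP.
Qed.

Lemma norm_cis t : `|cis t| = 1.
Proof. by apply/normC1; exact: cis_conj. Qed.

Lemma cis_neq0 t : cis t != 0.
Proof. by rewrite -normr_eq0 norm_cis oner_eq0. Qed.

Lemma normC1_cis c : `|c| = 1 -> exists t, c = cis t.
Proof.
case: c => a b; rewrite normc_def /= => /complexI/eqP.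
rewrite -[1]sqrtr1 eqr_sqrt ?ler01 ?addr_ge0 ?sqr_ge0// => /eqP ab1.
have a1 : -1 <= a <= 1.
  rewrite -ler_norml -(@expr_le1 _ 2)// real_normK ?num_real//.
  by rewrite -ab1 lerDl sqr_ge0.
have b2 : sin (acos a) ^+ 2 = b ^+ 2.
  by rewrite sin2cos2 acosK ?in_itv//= -ab1 addrC addKr.
move/eqP: b2; rewrite eqf_sqr => /orP[/eqP e|/eqP e].
  by exists (acos a); rewrite /cis acosK ?in_itv//= e.
by exists (- acos a); rewrite /cis cosN sinN acosK ?in_itv//= e opprK.
Qed.

End Cis.

(** * Derivatives of complex-valued functions *)

Section ComplexDerivative.
Context {R : realType} {V : normedModType R}.
Implicit Types (f g : V -> R[i]) (p v : V) (c l : R[i]).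

(** Relational form of the derivative computed by [deriveC], so that the usual
    calculation rules carry differentiability along. *)
Definition is_cderive p v f l :=
  is_derive p v (fun q => complex.Re (f q)) (complex.Re l) /\
  is_derive p v (fun q => complex.Im (f q)) (complex.Im l).

Lemma cRe_add (x y : R[i]) : complex.Re (x + y) = complex.Re x + complex.Re y.
Proof. by case: x y => [a b] [c d]. Qed.
Lemma cIm_add (x y : R[i]) : complex.Im (x + y) = complex.Im x + complex.Im y.
Proof. by case: x y => [a b] [c d]. Qed.
Lemma cRe_mul (x y : R[i]) : complex.Re (x * y) =
  complex.Re x * complex.Re y - complex.Im x * complex.Im y.
Proof. by case: x y => [a b] [c d]. Qed.
Lemma cIm_mul (x y : R[i]) : complex.Im (x * y) =
  complex.Re x * complex.Im y + complex.Im x * complex.Re y.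
Proof. by case: x y => [a b] [c d]. Qed.
Lemma cRe_conj (x : R[i]) : complex.Re x^* = complex.Re x.
Proof. by case: x. Qed.
Lemma cIm_conj (x : R[i]) : complex.Im x^* = - complex.Im x.
Proof. by case: x. Qed.
Lemma complex_ext (x y : R[i]) :
  complex.Re x = complex.Re y -> complex.Im x = complex.Im y -> x = y.
Proof. by case: x y => [a b] [c d] /= -> ->. Qed.

Lemma is_cderive_eq p v f l l' : is_cderive p v f l -> l = l' -> is_cderive p v f l'.
Proof. by move=> + <-. Qed.

Lemma is_cderive_cst p v c : is_cderive p v (fun=> c) 0.
Proof. by split; exact: is_derive_cst. Qed.

Lemma is_cderive_add p v f g l k : is_cderive p v f l -> is_cderive p v g k ->
  is_cderive p v (fun q => f q + g q) (l + k).
Proof.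
move=> [f1 f2] [g1 g2]; split.
  under eq_fun do rewrite cRe_add; rewrite cRe_add; exact: is_deriveD.
under eq_fun do rewrite cIm_add; rewrite cIm_add; exact: is_deriveD.
Qed.

Lemma is_cderive_mul p v f g l k : is_cderive p v f l -> is_cderive p v g k ->
  is_cderive p v (fun q => f q * g q) (l * g p + f p * k).
Proof.
move=> [f1 f2] [g1 g2]; split.
  under eq_fun do rewrite cRe_mul.
  apply: is_derive_eq (is_deriveB (is_deriveM f1 g1) (is_deriveM f2 g2)) _.
  by rewrite cRe_add !cRe_mul /GRing.scale /=; ring.
under eq_fun do rewrite cIm_mul.
apply: is_derive_eq (is_deriveD (is_deriveM f1 g2) (is_deriveM f2 g1)) _.
by rewrite cIm_add !cIm_mul /GRing.scale /=; ring.
Qed.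

Lemma is_cderive_conj p v f l : is_cderive p v f l ->
  is_cderive p v (fun q => (f q)^*) (l^*).
Proof.
move=> [f1 f2]; split.
  by under eq_fun do rewrite cRe_conj; rewrite cRe_conj.
under eq_fun do rewrite cIm_conj; rewrite cIm_conj; exact: is_deriveN.
Qed.

Lemma is_cderive_sum (I : Type) (r : seq I) p v (f : I -> V -> R[i]) (l : I -> R[i]) :
  (forall i, is_cderive p v (f i) (l i)) ->
  is_cderive p v (fun q => \sum_(i <- r) f i q) (\sum_(i <- r) l i).
Proof.
move=> fl; elim: r => [|i r IH].
  by under eq_fun do rewrite big_nil; rewrite big_nil; exact: is_cderive_cst.
by under eq_fun do rewrite big_cons; rewrite big_cons; exact: is_cderive_add.
Qed.

Lemma is_cderive_near p v f g l : (\near p, f p = g p) ->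
  is_cderive p v f l -> is_cderive p v g l.
Proof.
move=> fg [f1 f2]; split.
  by apply: near_eq_is_derive f1; near=> q; congr complex.Re; near: q.
by apply: near_eq_is_derive f2; near=> q; congr complex.Im; near: q.
Unshelve. all: end_near. Qed.

Lemma is_cderive_unique p v f l k :
  is_cderive p v f l -> is_cderive p v f k -> l = k.
Proof.
move=> [f1 f2] [g1 g2]; apply: complex_ext.
  by rewrite -(@derive_val _ _ _ _ _ _ _ f1) (@derive_val _ _ _ _ _ _ _ g1).
by rewrite -(@derive_val _ _ _ _ _ _ _ f2) (@derive_val _ _ _ _ _ _ _ g2).
Qed.

End ComplexDerivative.

(** * Exponential sums on the plane *)

Section ExpSum.
Context {R : realType}.
Implicit Types (p q v : R * R) (f g : R * R -> R[i]).

Definition lin (a b : R) q : R := a * q.1 + b * q.2.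

Lemma linD a b q v : lin a b (q + v) = lin a b q + lin a b v.
Proof. by rewrite /lin /=; ring. Qed.

Lemma linZ a b (h : R) q : lin a b (h *: q) = h * lin a b q.
Proof. by rewrite /lin /= /GRing.scale /=; ring. Qed.

Lemma continuous_lin a b : continuous (lin a b).
Proof.
move=> q; apply: cvgD; apply: cvgM; try exact: cvg_cst.
  exact: cvg_fst.
exact: cvg_snd.
Qed.

(** The directional difference quotient of [f] at [p] is literally that of the
    restriction of [f] to the line through [p]. *)
Lemma is_derive_line (f : R * R -> R) (d : R) p v :
  is_derive (0 : R) (1 : R) (fun h : R => f (h *: v + p)) d -> is_derive p v f d.
Proof.
move=> [D1 D2].
have E : (fun h : R => h^-1 *: (((fun h : R => f (h *: v + p)) \o shift 0) (h *: (1 : R)) -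
    (fun h : R => f (h *: v + p)) 0)) = (fun h => h^-1 *: ((f \o shift p) (h *: v) - f p)).
  apply/funext => h /=.
  by rewrite addr0 [h *: (1 : R)]mulr1 scale0r add0r.
split; first by move: D1; rewrite /derivable E.
by rewrite -D2 /derive E.
Qed.

Lemma is_derive_affine (s c x : R) :
  is_derive x (1 : R) (fun h : R => h * s + c) s.
Proof.
have /is_derive_eq := is_deriveD (is_deriveM (is_derive_id x (1 : R))
  (is_derive_cst s x (1 : R))) (is_derive_cst c x (1 : R)).
by apply; rewrite addr0 scaler0 add0r; exact: mulr1.
Qed.

Lemma is_derive_lin (f : R -> R) (d a b : R) p v :
  is_derive (lin a b p) (1 : R) f d ->
  is_derive p v (fun q => f (lin a b q)) (lin a b v * d).
Proof.
move=> fd; apply: is_derive_line.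
under eq_fun do rewrite linD linZ.
rewrite mulrC; apply: (@is_derive1_comp _ f (fun h => h * lin a b v + lin a b p)).
  by rewrite mul0r add0r.
exact: is_derive_affine.
Qed.

Lemma is_cderive_cis a b p v : is_cderive p v (fun q => cis (lin a b q))
  (('i * (lin a b v)%:C) * cis (lin a b p)).
Proof.
split.
  by apply: is_derive_eq (is_derive_lin _ (is_derive_cos _)) _; rewrite -complexiE /=; ring.
by apply: is_derive_eq (is_derive_lin _ (is_derive_sin _)) _; rewrite -complexiE /=; ring.
Qed.

(** Finite sums of plane waves: a class of functions closed under products and
    derivatives, which contains the coordinates of all the explicit lifts, so
    that their smoothness needs no separate argument. *)
Inductive expsum : (R * R -> R[i]) -> Prop :=
| expsum_cis c a b : expsum (fun q => c * cis (lin a b q))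
| expsum_add f g : expsum f -> expsum g -> expsum (fun q => f q + g q).

Lemma expsum_cst c : expsum (fun=> c).
Proof.
have -> : (fun=> c) = (fun q => c * cis (lin 0 0 q)); last exact: expsum_cis.
by apply/funext => q; rewrite /lin !mul0r add0r cis0 mulr1.
Qed.

Lemma expsum_mul f g : expsum f -> expsum g -> expsum (fun q => f q * g q).
Proof.
elim=> [c a b|f1 f2 _ IH1 _ IH2] Hg; last first.
  by under eq_fun do rewrite mulrDl; apply: expsum_add; [exact: IH1|exact: IH2].
elim: Hg => [d k l|g1 g2 _ IH1 _ IH2]; last first.
  by under eq_fun do rewrite mulrDr; apply: expsum_add.
have -> : (fun q => c * cis (lin a b q) * (d * cis (lin k l q))) =
    (fun q => (c * d) * cis (lin (a + k) (b + l) q)); last exact: expsum_cis.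
apply/funext => q; have -> : lin (a + k) (b + l) q = lin a b q + lin k l q.
  by rewrite /lin; ring.
by rewrite cisD; ring.
Qed.

Lemma expsum_sum (I : Type) (r : seq I) (f : I -> R * R -> R[i]) :
  (forall i, expsum (f i)) -> expsum (fun q => \sum_(i <- r) f i q).
Proof.
move=> fE; elim: r => [|i r IH].
  by under eq_fun do rewrite big_nil; exact: expsum_cst.
by under eq_fun do rewrite big_cons; exact: expsum_add.
Qed.

Lemma expsum_derive f v : expsum f ->
  exists2 f', expsum f' & forall p, is_cderive p v f (f' p).
Proof.
elim=> [c a b|f1 f2 _ [g1 E1 D1] _ [g2 E2 D2]].
  exists (fun q => (c * ('i * (lin a b v)%:C)) * cis (lin a b q)).
    exact: expsum_cis.
  move=> p; apply: is_cderive_eq.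
    exact: is_cderive_mul (is_cderive_cst _ _ _) (is_cderive_cis _ _ _ _).
  by rewrite mul0r add0r mulrA.
by exists (fun q => g1 q + g2 q) => [|p]; [exact: expsum_add|exact: is_cderive_add].
Qed.

Lemma expsum_continuous f : expsum f ->
  continuous (fun q => complex.Re (f q)) /\ continuous (fun q => complex.Im (f q)).
Proof.
elim=> [c a b|f1 f2 _ [R1 I1] _ [R2 I2]].
  have ccos : continuous (fun q => cos (lin a b q)).
    by move=> q; apply: continuous_comp; [exact: continuous_lin|exact: continuous_cos].
  have csin : continuous (fun q => sin (lin a b q)).
    by move=> q; apply: continuous_comp; [exact: continuous_lin|exact: continuous_sin].
  split; [set h := fun q => _; have -> : h = (fun q => complex.Re c * cos (lin a b q)
      - complex.Im c * sin (lin a b q)) by apply/funext => q; rewrite /h cRe_mul|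
    set h := fun q => _; have -> : h = (fun q => complex.Re c * sin (lin a b q)
      + complex.Im c * cos (lin a b q)) by apply/funext => q; rewrite /h cIm_mul].
    by move=> q; apply: cvgB; apply: cvgM;
      [exact: cvg_cst|exact: ccos|exact: cvg_cst|exact: csin].
  by move=> q; apply: cvgD; apply: cvgM;
    [exact: cvg_cst|exact: csin|exact: cvg_cst|exact: ccos].
split=> q.
  rewrite (_ : (fun q => _) = (fun q => complex.Re (f1 q) + complex.Re (f2 q))).
    by apply: cvgD; [exact: R1|exact: R2].
  by apply/funext => r; rewrite cRe_add.
rewrite (_ : (fun q => _) = (fun q => complex.Im (f1 q) + complex.Im (f2 q))).
  by apply: cvgD; [exact: I1|exact: I2].
by apply/funext => r; rewrite cIm_add.
Qed.

(** The derivatives of an exponential sum are again such sums, hence continuous;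
    the induction on the order of differentiability follows. *)
Lemma expsum_smooth W f : expsum f ->
  smooth W (fun q => complex.Re (f q)) /\ smooth W (fun q => complex.Im (f q)).
Proof.
move=> fE.
suff H n : Ck n W (fun q => complex.Re (f q)) /\ Ck n W (fun q => complex.Im (f q)).
  by split=> n; case: (H n).
elim: n f fE => [|n IH] f fE; have [cR cI] := expsum_continuous fE.
  by split; split=> // p _; [exact: cR|exact: cI].
split; (split; first by move=> p _; [exact: cR || exact: cI]) => v;
  have [f' f'E D] := expsum_derive v fE; have [kR kI] := IH _ f'E; split.
- by move=> p _; case: (D p) => d _; exact: (@ex_derive _ _ _ _ _ _ _ d).
- rewrite (_ : 'D_v _ = fun q => complex.Re (f' q))//.
  by apply/funext => p; case: (D p) => d _; exact: (@derive_val _ _ _ _ _ _ _ d).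
- by move=> p _; case: (D p) => _ d; exact: (@ex_derive _ _ _ _ _ _ _ d).
- rewrite (_ : 'D_v _ = fun q => complex.Im (f' q))//.
  by apply/funext => p; case: (D p) => _ d; exact: (@derive_val _ _ _ _ _ _ _ d).
Qed.

End ExpSum.

(** * Hermitian algebra and unitary diagonalization *)

Section Hermitian.
Context {R : realType}.
Implicit Types (z w : 'cV[R[i]]_3) (c : R[i]) (N : 'M[R[i]]_3) (d e : 'rV[R[i]]_3).

Lemma hermDl z1 z2 w : herm (z1 + z2) w = herm z1 w + herm z2 w.
Proof. by rewrite /herm -big_split; apply: eq_bigr => k _; rewrite !mxE mulrDl. Qed.

Lemma hermZl c z w : herm (c *: z) w = c * herm z w.
Proof. by rewrite /herm mulr_sumr; apply: eq_bigr => k _; rewrite !mxE mulrA. Qed.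

Lemma herm_conj z w : (herm z w)^* = herm w z.
Proof.
rewrite /herm rmorph_sum; apply: eq_bigr => k _.
by rewrite rmorphM /= conjCK mulrC.
Qed.

Lemma hermDr z w1 w2 : herm z (w1 + w2) = herm z w1 + herm z w2.
Proof. by rewrite -herm_conj hermDl rmorphD /= !herm_conj. Qed.

Lemma hermZr c z w : herm z (c *: w) = c^* * herm z w.
Proof. by rewrite -herm_conj hermZl rmorphM /= herm_conj. Qed.

Lemma herm0l w : herm 0 w = 0.
Proof. by rewrite -(scale0r (0 : 'cV_3)) hermZl mul0r. Qed.

Lemma herm_eq0 z : herm z z = 0 -> z = 0.
Proof.
move=> z0; apply/colP => k; rewrite mxE; apply/eqP; rewrite -mul_conjC_eq0.
have zk j : 0 <= z j 0 * (z j 0)^* by exact: mul_conjC_ge0.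
have : \sum_j z j 0 * (z j 0)^* == 0 by apply/eqP.
by rewrite psumr_eq0// => /allP/(_ k); rewrite mem_index_enum; exact.
Qed.

Lemma herm_mulmx N z w : herm (N *m z) w = herm z (N^t* *m w).
Proof.
rewrite /herm; under eq_bigr => k _ do rewrite mxE mulr_suml.
rewrite exchange_big; apply: eq_bigr => j _.
rewrite mxE rmorph_sum mulr_sumr; apply: eq_bigr => k _.
by rewrite !mxE rmorphM /= conjCK; ring.
Qed.

Lemma unitarymx_trmul N : N \is unitarymx -> N^t* *m N = 1%:M.
Proof. by move=> /unitarymxP/mulmx1C. Qed.

Lemma herm_unitary N z w : N \is unitarymx -> herm (N *m z) (N *m w) = herm z w.
Proof. by move=> uN; rewrite herm_mulmx mulmxA unitarymx_trmul// mul1mx. Qed.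

Lemma herm_skew N z w : skew_hermitian N -> herm (N *m z) w = - herm z (N *m w).
Proof. by move=> sN; rewrite herm_mulmx sN mulNmx -scaleN1r hermZr rmorphN1 mulN1r. Qed.

(** The matrix with eigenvalues [d] in the orthonormal basis formed by the
    conjugate transposes of the rows of [N], for [N] unitary. *)
Definition udiag N (d : 'rV[R[i]]_3) : 'M[R[i]]_3 := N^t* *m diag_mx d *m N.

Lemma udiagD N d e : udiag N (d + e) = udiag N d + udiag N e.
Proof. by rewrite /udiag raddfD mulmxDr mulmxDl. Qed.

Lemma udiagB N d e : udiag N (d - e) = udiag N d - udiag N e.
Proof. by rewrite /udiag raddfB mulmxBr mulmxBl. Qed.

Lemma udiagZ N c d : udiag N (c *: d) = c *: udiag N d.
Proof. by rewrite /udiag linearZ -scalemxAr -scalemxAl. Qed.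

Lemma udiag_trmxC N d : (udiag N d)^t* = udiag N (map_mx Num.conj d).
Proof.
rewrite /udiag !trmx_mul !map_mxM mulmxA tr_diag_mx map_diag_mx.
by rewrite -map_trmx trmxK -map_mx_comp (map_mx_id (@conjCK _)).
Qed.

Lemma udiag_mulmx N d w :
  udiag N d *m w = N^t* *m (diag_mx d *m (N *m w)).
Proof. by rewrite /udiag; move: (N^t*) => N'; rewrite !mulmxA. Qed.

Lemma udiagM N d e : N \is unitarymx ->
  udiag N d *m udiag N e = udiag N (\row_k (d 0 k * e 0 k)).
Proof.
move=> /unitarymxP; rewrite /udiag -mulmx_diag; move: (N^t*) => N' uN.
by rewrite !mulmxA -(mulmxA _ N N') uN mulmx1.
Qed.

Lemma udiag1 N : N \is unitarymx -> udiag N (const_mx 1) = 1%:M.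
Proof. by move=> uN; rewrite /udiag diag_const_mx mulmx1 unitarymx_trmul. Qed.

Lemma udiagE N d i j : udiag N d i j = \sum_k (N k i)^* * N k j * d 0 k.
Proof. by rewrite mxE; apply: eq_bigr => k _; rewrite mul_mx_diag !mxE; ring. Qed.

(** Commuting skew-Hermitian matrices are the parts of the normal matrix
    [A + 'i B], so that its unitary diagonalization diagonalizes both. *)
Lemma skew_codiag (A B : 'M[R[i]]_3) :
  skew_hermitian A -> skew_hermitian B -> A *m B = B *m A ->
  exists P (a b : 'I_3 -> R), [/\ P \is unitarymx,
    A = udiag P (\row_k ('i * (a k)%:C)) & B = udiag P (\row_k ('i * (b k)%:C))].
Proof.
move=> sA sB AB; pose N := A + 'i *: B.
have NE : N^t* = - A + 'i *: B.
  rewrite /N linearD linearZ /= map_mxD map_mxZ sA sB /=.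
  by rewrite conjCi scaleNr scalerN opprK.
have nN : N \is normalmx.
  apply/normalmxP; rewrite NE /N !mulmxDl !mulmxDr -!scalemxAl -!scalemxAr.
  by rewrite !mulmxN !mulNmx !scalerN AB addrACA.
have [P [s [uP NP]]] : exists P s, P \is unitarymx /\ N = udiag P s.
  have uP := spectral_unitarymx N.
  move/orthomx_spectralP: nN; rewrite invmx_unitary// => NP.
  by exists (spectralmx N), (spectral_diag N).
have NP' : N^t* = udiag P (map_mx Num.conj s) by rewrite [in LHS]NP udiag_trmxC.
have i0 : 'i != 0 :> R[i] by exact: neq0Ci.
have two0 : 2 != 0 :> R[i] by rewrite pnatr_eq0.
have AE : A = 2^-1 *: (N - N^t*).
  have -> : N - N^t* = (2 : R[i]) *: A.
    by rewrite NE /N opprD opprK addrACA subrr addr0 scaler_nat mulr2n.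
  by rewrite scalerA mulVf// scale1r.
have BE : B = (2 * 'i)^-1 *: (N + N^t*).
  have -> : N + N^t* = (2 * 'i : R[i]) *: B.
    by rewrite NE /N addrACA subrr add0r -scalerA scaler_nat mulr2n.
  by rewrite scalerA mulVf ?scale1r// mulf_neq0.
exists P, (fun k => complex.Im (s 0 k)), (fun k => - complex.Re (s 0 k)).
split; first exact: uP.
  rewrite AE NP' NP -udiagB -udiagZ; congr udiag; apply/rowP => k; rewrite !mxE.
  apply: (mulfI two0); rewrite mulrA mulfV// mul1r.
  by rewrite -complexiE; case: (s 0 k) => x y; apply: complex_ext; rewrite /=; ring.
rewrite BE NP' NP -udiagD -udiagZ; congr udiag; apply/rowP => k; rewrite !mxE.
apply: (@mulfI _ (2 * 'i)); first by rewrite mulf_neq0.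
rewrite mulrA mulfV ?mulf_neq0// mul1r.
by rewrite -complexiE; case: (s 0 k) => x y; apply: complex_ext; rewrite /=; ring.
Qed.

End Hermitian.

(** * The matrix exponential in a unitary basis *)

Section Exponential.
Context {R : realType}.
Implicit Types (t : R) (A P : 'M[R[i]]_3).

Lemma exprCi k : ('i : R[i]) ^+ k =
  ((~~ odd k)%:R * (-1) ^+ k./2) +i* ((odd k)%:R * (-1) ^+ k./2).
Proof.
rewrite -{1}(odd_double_half k) exprD -mul2n exprM sqrCi -complexiE.
have -> : ((-1) ^+ k./2 : R[i]) = ((-1) ^+ k./2 : R)%:C by rewrite rmorphXn /= rmorphN1.
by case: (odd k); rewrite ?expr1 ?expr0; apply: complex_ext => /=; ring.
Qed.

Definition expC_psum (t : R) (N : nat) : R[i] :=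
  \sum_(k < N) (k`!%:R)^-1 * ('i * t%:C) ^+ k.

Lemma expC_psumE t N : expC_psum t N =
  series (cos_coeff t) N +i* series (sin_coeff t) N.
Proof.
rewrite /expC_psum /series /= !big_mkord.
elim: N => [|N IH]; first by rewrite !big_ord0.
rewrite !big_ord_recr /= IH.
have -> : (N`!%:R : R[i])^-1 * ('i * t%:C) ^+ N = cos_coeff t N +i* sin_coeff t N.
  rewrite exprMn exprCi -rmorphXn /= -(rmorph_nat (real_complex R)) -fmorphV /=.
  apply: complex_ext; rewrite /cos_coeff /sin_coeff /= -?exprnP; first by ring.
  suff -> : (odd N)%:R * (-1) ^+ N.-1./2 = (odd N)%:R * (-1) ^+ N./2 :> R by ring.
  by case: N {IH} => //= N; rewrite uphalf_half; case: (odd N); rewrite ?mul0r.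
by [].
Qed.

Lemma cvg_expC_psum t :
  (fun N => complex.Re (expC_psum t N)) @ \oo --> complex.Re (cis t) /\
  (fun N => complex.Im (expC_psum t N)) @ \oo --> complex.Im (cis t).
Proof.
split.
  under eq_fun do rewrite expC_psumE /=.
  by rewrite /cis /= cos.unlock; exact: is_cvg_series_cos_coeff.
under eq_fun do rewrite expC_psumE /=.
by rewrite /cis /= sin.unlock; exact: is_cvg_series_sin_coeff.
Qed.

Lemma udiagX P (d : 'rV[R[i]]_3) k : P \is unitarymx ->
  udiag P d ^+ k = udiag P (\row_l d 0 l ^+ k).
Proof.
move=> uP; elim: k => [|k IH].
  by rewrite (_ : \row_l _ = const_mx 1) ?udiag1//; apply/rowP => l; rewrite !mxE.
have -> : udiag P d ^+ k.+1 = udiag P d *m udiag P d ^+ k by rewrite exprS.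
rewrite IH (udiagM _ _ uP); congr udiag.
by apply/rowP => l; rewrite !mxE exprS.
Qed.

Lemma cvg_parts_sum (c : 'I_3 -> R[i]) (z : 'I_3 -> R[i]) (f : 'I_3 -> nat -> R[i]) :
  (forall l, (fun N => complex.Re (f l N)) @ \oo --> complex.Re (z l) /\
             (fun N => complex.Im (f l N)) @ \oo --> complex.Im (z l)) ->
  (fun N => complex.Re (\sum_l c l * f l N)) @ \oo --> complex.Re (\sum_l c l * z l) /\
  (fun N => complex.Im (\sum_l c l * f l N)) @ \oo --> complex.Im (\sum_l c l * z l).
Proof.
move=> fz; elim: (index_enum _) => [|l r [IHr IHi]].
  by split; under eq_fun do rewrite big_nil; rewrite big_nil; exact: cvg_cst.
have [zr zi] := fz l; split; under eq_fun do rewrite big_cons; rewrite big_cons.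
  rewrite (_ : (fun N => _) = (fun N => (complex.Re (c l) * complex.Re (f l N)
    - complex.Im (c l) * complex.Im (f l N)) + complex.Re (\sum_(l <- r) c l * f l N))).
    rewrite cRe_add cRe_mul.
    by apply: cvgD IHr; apply: cvgB; apply: cvgM => //; exact: cvg_cst.
  by apply/funext => N; rewrite cRe_add cRe_mul.
rewrite (_ : (fun N => _) = (fun N => (complex.Re (c l) * complex.Im (f l N)
  + complex.Im (c l) * complex.Re (f l N)) + complex.Im (\sum_(l <- r) c l * f l N))).
  rewrite cIm_add cIm_mul.
  by apply: cvgD IHi; apply: cvgD; apply: cvgM => //; exact: cvg_cst.
by apply/funext => N; rewrite cIm_add cIm_mul.
Qed.

(** Each power of a diagonalized matrix is diagonalized in the same basis, so the
    entries of the partial sums are fixed combinations of partial sums of scalar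
    exponential series. *)
Lemma expmx_udiag P (a : 'I_3 -> R) t : P \is unitarymx ->
  expmx (t%:C *: udiag P (\row_k ('i * (a k)%:C))) = udiag P (\row_k cis (t * a k)).
Proof.
move=> uP; rewrite -udiagZ; apply/matrixP => i j; rewrite udiagE mxE.
pose c l := (P l i)^* * P l j.
set d := t%:C *: _.
have dE l : d 0 l = 'i * (t * a l)%:C by rewrite !mxE rmorphM mulrCA.
have E N : (\sum_(k < N) k`!%:R^-1 *: udiag P d ^+ k) i j =
    \sum_l c l * expC_psum (t * a l) N.
  rewrite summxE; under [RHS]eq_bigr => l _ do rewrite mulr_sumr.
  rewrite exchange_big; apply: eq_bigr => k _; rewrite /=.
  rewrite udiagX// mxE udiagE mulr_sumr; apply: eq_bigr => l _.
  by rewrite mxE dE /c; ring.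
have [cR cI] := cvg_parts_sum c (z := fun l => cis (t * a l))
  (fun l => cvg_expC_psum (t * a l)).
under eq_fun do rewrite E.
under [X in _ +i* limn X]eq_fun do rewrite E.
rewrite (cvg_lim _ cR)// (cvg_lim _ cI)//.
under [RHS]eq_bigr do rewrite mxE.
by rewrite [RHS]complexE; apply: complex_ext => /=; ring.
Qed.

End Exponential.

(** * Derivatives of vector-valued functions *)

Section VectorDerivative.
Context {R : realType} {V : normedModType R}.
Implicit Types (p v : V) (X Y : V -> 'cV[R[i]]_3) (dX dY : 'cV[R[i]]_3).

Definition is_vderive p v X (dX : 'cV[R[i]]_3) :=
  forall k, is_cderive p v (fun q => X q k 0) (dX k 0).

Lemma is_vderive_cst p v (z : 'cV[R[i]]_3) : is_vderive p v (fun=> z) 0.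
Proof. by move=> k; rewrite mxE; exact: is_cderive_cst. Qed.

Lemma is_vderive_sub p v X Y dX dY : is_vderive p v X dX -> is_vderive p v Y dY ->
  is_vderive p v (fun q => X q - Y q) (dX - dY).
Proof.
move=> DX DY k; rewrite !mxE -mulN1r.
under eq_fun do rewrite !mxE -mulN1r.
apply: is_cderive_add => //.
apply: is_cderive_eq (is_cderive_mul (is_cderive_cst _ _ (-1)) (DY k)) _.
by rewrite mul0r add0r.
Qed.

Lemma is_vderive_mulmx p v (N : V -> 'M[R[i]]_3) (dN : 'M[R[i]]_3) X dX :
  (forall i j, is_cderive p v (fun q => N q i j) (dN i j)) ->
  is_vderive p v X dX ->
  is_vderive p v (fun q => N q *m X q) (dN *m X p + N p *m dX).
Proof.
move=> DN DX k; under eq_fun do rewrite mxE.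
rewrite !mxE -big_split /=; apply: is_cderive_sum => j.
exact: is_cderive_mul.
Qed.

Lemma is_vderive_mull p v (N : 'M[R[i]]_3) X dX : is_vderive p v X dX ->
  is_vderive p v (fun q => N *m X q) (N *m dX).
Proof.
move=> DX; have -> : N *m dX = 0 *m X p + N *m dX by rewrite mul0mx add0r.
by apply: is_vderive_mulmx => // i j; rewrite mxE; exact: is_cderive_cst.
Qed.

Lemma is_vderive_scale p v (c : V -> R[i]) (dc : R[i]) X dX :
  is_cderive p v c dc -> is_vderive p v X dX ->
  is_vderive p v (fun q => c q *: X q) (dc *: X p + c p *: dX).
Proof.
move=> Dc DX k; under eq_fun do rewrite mxE.
by rewrite !mxE; exact: is_cderive_mul.
Qed.

Lemma is_cderive_herm p v X Y dX dY : is_vderive p v X dX -> is_vderive p v Y dY ->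
  is_cderive p v (fun q => herm (X q) (Y q)) (herm dX (Y p) + herm (X p) dY).
Proof.
move=> DX DY; rewrite /herm -big_split; apply: is_cderive_sum => k /=.
by apply: is_cderive_mul => //; exact: is_cderive_conj.
Qed.

Lemma is_vderive_unique p v X (X1 X2 : 'cV[R[i]]_3) :
  is_vderive p v X X1 -> is_vderive p v X X2 -> X1 = X2.
Proof.
by move=> D1 D2; apply/colP => k; exact: is_cderive_unique (D1 k) (D2 k).
Qed.

Lemma is_vderive_near p v X Y dX : (\near p, X p = Y p) ->
  is_vderive p v X dX -> is_vderive p v Y dX.
Proof.
move=> XY DX k; apply: is_cderive_near (DX k).
by near=> q; rewrite (_ : X q = Y q)//; near: q.
Unshelve. all: end_near. Qed.

Lemma deriveC_val p v X dX : is_vderive p v X dX -> deriveC X p v = dX.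
Proof.
move=> DX; apply/colP => k; rewrite mxE; case: (DX k) => d1 d2.
by rewrite (@derive_val _ _ _ _ _ _ _ d1) (@derive_val _ _ _ _ _ _ _ d2); case: (dX k 0).
Qed.

Lemma smoothC_is_deriveV W X p v : smoothC W X -> W p ->
  is_vderive p v X (deriveC X p v).
Proof.
move=> sX Wp k; have [/(_ 1) [_ /(_ v) [dR _]] /(_ 1) [_ /(_ v) [dI _]]] := sX k.
by rewrite mxE; split; apply: derivableP; [exact: dR|exact: dI].
Qed.

(** A curve that stays in the complex lines of a curve [Y] on the sphere has the
    coefficient [herm X Y], which is differentiable whenever [X] and [Y] are; the
    derivative of [X] then follows from the product rule.  The value of the
    component along [Y p] is left unspecified. *)
Lemma is_vderive_line p v X Y dX dY :
  is_vderive p v X dX -> is_vderive p v Y dY ->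
  (forall q, herm (Y q) (Y q) = 1) -> (forall q, exists c, X q = c *: Y q) ->
  exists k, dX = k *: Y p + herm (X p) (Y p) *: dY.
Proof.
move=> DX DY Y1 XY.
have E : X = (fun q => herm (X q) (Y q) *: Y q).
  by apply/funext => q; have [c ->] := XY q; rewrite hermZl Y1 mulr1.
have Dc := is_cderive_herm DX DY.
exists (herm dX (Y p) + herm (X p) dY).
apply: is_vderive_unique DX _; rewrite [X in is_vderive _ _ X]E.
exact: is_vderive_scale.
Qed.

End VectorDerivative.

(** * Complex independence of Lagrangian frames *)

Section Independence.
Context {R : realType}.
Implicit Types (z a b w : 'cV[R[i]]_3).

Lemma mulmx_det3 z a b (N : 'M[R[i]]_3) :
  det3 (N *m z) (N *m a) (N *m b) = \det N * det3 z a b.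
Proof.
rewrite /det3 -det_mulmx; congr (\det _); apply/matrixP => i j; rewrite !mxE.
by case: j => [[|[|[|//]]]] /= ?; rewrite !mxE; apply: eq_bigr => k _; rewrite !mxE.
Qed.

Lemma det3_eq0 z a b : det3 z a b = 0 -> exists c0 c1 c2 : R[i],
  c0 *: z + c1 *: a + c2 *: b = 0 /\ ~ [/\ c0 = 0, c1 = 0 & c2 = 0].
Proof.
rewrite /det3 -det_tr => /eqP/det0P[v v0 vS].
exists (v 0 0), (v 0 1), (v 0 2%:R); split.
  apply/colP => k; have /rowP/(_ k) := vS.
  rewrite !mxE !big_ord_recl big_ord0 !mxE /= addr0 => <-.
  by rewrite addrA; congr (_ * _ + v 0 _ * _ + v 0 _ * _); apply/val_inj.
case=> e0 e1 e2; move/eqP: v0; apply; apply/rowP => -[[|[|[|//]]]] /= lt3; rewrite [RHS]mxE.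
- by rewrite -[RHS]e0; congr (v 0 _); apply/val_inj.
- by rewrite -[RHS]e1; congr (v 0 _); apply/val_inj.
- by rewrite -[RHS]e2; congr (v 0 _); apply/val_inj.
Qed.

Lemma hprojD z a b : hproj z (a + b) = hproj z a + hproj z b.
Proof. by rewrite /hproj hermDl scalerDl opprD addrACA. Qed.

Lemma hprojZ (c : R[i]) z a : hproj z (c *: a) = c *: hproj z a.
Proof. by rewrite /hproj hermZl scalerBr scalerA. Qed.

Lemma kahlerE z w : kahler z w = - complex.Im (herm z w).
Proof.
by rewrite /kahler hermZl -complexiE; case: (herm z w) => x y /=; ring.
Qed.

Lemma Im_herm_self z : complex.Im (herm z z) = 0.
Proof.
have /(congr1 (@complex.Im R)) := herm_conj z z; rewrite cIm_conj => /eqP.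
by rewrite -subr_eq0 -opprD oppr_eq0 -mulr2n mulrn_eq0 /= => /eqP.
Qed.

(** Real independence of the horizontal vectors suffices: split a complex relation
    as [X + iY = 0] with [X] and [Y] in their real span.  Then [herm X Y] is real
    by the Lagrangian condition, while [herm X X = i herm X Y] is also real, so
    both vanish. *)
Lemma det3_neq0 z a b : herm z z = 1 ->
  kahler (hproj z a) (hproj z b) = 0 ->
  (forall s t : R, s%:C *: hproj z a + t%:C *: hproj z b = 0 -> s = 0 /\ t = 0) ->
  det3 z a b != 0.
Proof.
move=> z1 /eqP; rewrite kahlerE oppr_eq0 => /eqP ab0 indep.
apply/eqP => /det3_eq0[c0 [c1 [c2 [E nz]]]]; apply: nz.
have /= := congr1 (hproj z) E; rewrite !hprojD !hprojZ.
rewrite {1 4}/hproj z1 scale1r subrr scaler0 add0r herm0l scale0r subr0.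
move=> E'; move: (hproj z a) (hproj z b) ab0 indep E' => a' b' ab0 indep E'.
pose X := (complex.Re c1)%:C *: a' + (complex.Re c2)%:C *: b'.
pose Y := (complex.Im c1)%:C *: a' + (complex.Im c2)%:C *: b'.
have XY : X + 'i *: Y = 0.
  rewrite -E' /X /Y; apply/colP => k; rewrite !mxE.
  by rewrite [in RHS](complexE c1) [in RHS](complexE c2) complexiE; ring.
have hXY : complex.Im (herm X Y) = 0.
  have ba0 : complex.Im (herm b' a') = 0 by rewrite -herm_conj cIm_conj ab0 oppr0.
  rewrite /X /Y !(hermDl, hermDr, hermZl, hermZr).
  rewrite !(cIm_add, cIm_mul, cRe_add, cRe_mul, cIm_conj, cRe_conj) /= ab0 ba0 !Im_herm_self.
  by ring.
have XE : X = - ('i *: Y) by apply/eqP; rewrite -addr_eq0 XY.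
have X0 : X = 0.
  apply: herm_eq0; have hXX : herm X X = 'i * herm X Y.
    by rewrite {2}XE -scaleNr hermZr rmorphN /= conjCi opprK.
  apply: complex_ext; last exact: Im_herm_self.
  by rewrite hXX -complexiE cRe_mul hXY /=; ring.
have Y0 : Y = 0.
  move: XE; rewrite X0 => /eqP; rewrite eq_sym oppr_eq0 scaler_eq0 => /orP[|/eqP//].
  by rewrite (negbTE (neq0Ci _)).
have [r1 r2] := indep _ _ X0; have [i1 i2] := indep _ _ Y0.
have e1 : c1 = 0 by apply: complex_ext.
have e2 : c2 = 0 by apply: complex_ext.
split=> //; move: E; rewrite e1 e2 !scale0r !addr0 => /(congr1 (herm^~ z)).
by rewrite /= hermZl z1 mulr1 herm0l.
Qed.

Lemma scalar_mx_det3 (C : 'M[R[i]]_3) mu z a b : det3 z a b != 0 ->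
  C *m z = mu *: z -> C *m a = mu *: a -> C *m b = mu *: b -> C = mu%:M.
Proof.
move=> d0 Cz Ca Cb; set S := \matrix_(i < 3, j < 3) ([:: z; a; b]`_j) i 0.
have uS : S \in unitmx by rewrite unitmxE unitfE.
apply: (can_inj (mulmxK uS)); apply/matrixP => i j; rewrite mul_scalar_mx.
case: j => [[|[|[|//]]]] /= lt3.
- by have /colP/(_ i) := Cz; rewrite !mxE /= => <-; apply: eq_bigr => k _; rewrite !mxE.
- by have /colP/(_ i) := Ca; rewrite !mxE /= => <-; apply: eq_bigr => k _; rewrite !mxE.
- by have /colP/(_ i) := Cb; rewrite !mxE /= => <-; apply: eq_bigr => k _; rewrite !mxE.
Qed.

End Independence.

(** * One-parameter groups of unitary matrices *)

Section SkewExponential.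
Context {R : realType}.
Implicit Types (A B : 'M[R[i]]_3) (s t r : R).

Lemma skew_expmx A : skew_hermitian A -> exists P (a : 'I_3 -> R),
  [/\ P \is unitarymx, A = udiag P (\row_k ('i * (a k)%:C)) &
   forall t, expmx (t%:C *: A) = udiag P (\row_k cis (t * a k))].
Proof.
move=> sA; have [P [a [_ [uP AE _]]]] := skew_codiag sA sA erefl.
exists P, a; split; [exact: uP|exact: AE|].
by move=> t; rewrite -(expmx_udiag a t uP) -AE.
Qed.

Lemma expmx_unitary A t : skew_hermitian A -> expmx (t%:C *: A) \is unitarymx.
Proof.
move=> /skew_expmx[P [a [uP _ ->]]]; apply/unitarymxP.
rewrite udiag_trmxC (udiagM _ _ uP) -[RHS](udiag1 uP); congr udiag.
by apply/rowP => k; rewrite !mxE cis_conj.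
Qed.

Lemma expmx0 A : skew_hermitian A -> expmx (0%:C *: A) = 1%:M.
Proof.
move=> /skew_expmx[P [a [uP _ ->]]].
rewrite -(udiag1 uP); congr udiag.
by apply/rowP => k; rewrite !mxE mul0r cis0.
Qed.

Lemma expmx_expsum A s r i j : skew_hermitian A ->
  expsum (fun q => expmx ((lin s r q)%:C *: A) i j).
Proof.
move=> /skew_expmx[P [a [uP _ E]]].
under eq_fun do rewrite E udiagE; apply: expsum_sum => l.
under eq_fun do rewrite mxE.
rewrite (_ : (fun q => _) = (fun q => (P l i)^* * P l j * cis (lin (s * a l) (r * a l) q))).
  exact: expsum_cis.
by apply/funext => q; congr (_ * cis _); rewrite /lin; ring.
Qed.

Lemma expmx_derive A s r v i j : skew_hermitian A ->
  is_cderive 0 v (fun q => expmx ((lin s r q)%:C *: A) i j) ((lin s r v)%:C * A i j).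
Proof.
move=> /skew_expmx[P [a [uP AE E]]].
under eq_fun do rewrite E udiagE; rewrite AE udiagE mulr_sumr; apply: is_cderive_sum => l.
under eq_fun do rewrite mxE.
rewrite (_ : (fun q => _) = (fun q => (P l i)^* * P l j * cis (lin (s * a l) (r * a l) q))).
  apply: is_cderive_eq.
    exact: is_cderive_mul (is_cderive_cst _ _ _) (is_cderive_cis _ _ _ _).
  rewrite mxE (_ : lin _ _ 0 = 0) ?cis0; last by rewrite /lin /= !mulr0 addr0.
  rewrite (_ : lin _ _ v = a l * lin s r v); last by rewrite /lin; ring.
  by rewrite rmorphM /=; ring.
by apply/funext => q; congr (_ * cis _); rewrite /lin; ring.
Qed.

End SkewExponential.

(** * Hopf fibers *)

Section Hopf.
Context {R : realType}.
Implicit Types (z w : 'cV[R[i]]_3) (c : R[i]).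

Lemma hopf_act (M : 'M[R[i]]_3) z : act M (hopf z) = hopf (M *m z).
Proof.
apply/seteqP; split=> [_ [w [c c1 ->] <-]|w [c c1 ->]].
  by exists c => //; rewrite scalemxAr.
by exists (c *: z); [exists c|rewrite scalemxAr].
Qed.

Lemma hopf_eq z w : hopf z = hopf w -> exists2 c, `|c| = 1 & z = c *: w.
Proof.
move=> zw; suff: hopf w z by [].
by rewrite -zw; exists 1; rewrite ?normr1 ?scale1r.
Qed.

Lemma hopfZ c z : `|c| = 1 -> hopf (c *: z) = hopf z.
Proof.
move=> c1; have c0 : c != 0 by rewrite -normr_eq0 c1 oner_eq0.
apply/seteqP; split=> w [d d1 ->].
  by exists (d * c); rewrite ?normrM ?d1 ?c1 ?mulr1// scalerA.
by exists (d / c); rewrite ?normrM ?normfV ?d1 ?c1 ?invr1 ?mulr1// scalerA divfK.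
Qed.

Lemma S5_unitary (M : 'M[R[i]]_3) z : M \is unitarymx -> S5 z -> S5 (M *m z).
Proof. by move=> uM zS; rewrite /S5 /mkset herm_unitary//; exact: zS. Qed.

End Hopf.

(** * Commutation of the two flows *)

Section Commutation.
Context {R : realType}.
Variables (u : R * R -> set 'cV[R[i]]_3) (A B : 'M[R[i]]_3) (z0 : 'cV[R[i]]_3).
Hypotheses (sA : skew_hermitian A) (sB : skew_hermitian B).
Hypothesis u_act : forall x y t, u (x + t, y) = act (expmx (t%:C *: A)) (u (x, y)) /\
                      u (x, y + t) = act (expmx (t%:C *: B)) (u (x, y)).
Hypotheses (z0S : S5 z0) (uz0 : u (0, 0) = hopf z0).

Implicit Types (v p q : R * R) (w : 'cV[R[i]]_3) (X : R * R -> 'cV[R[i]]_3).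

Let eA (q : R * R) := expmx ((lin 1 0 q)%:C *: A).
Let eB (q : R * R) := expmx ((lin 0 1 q)%:C *: B).

Lemma lin10 (q : R * R) : lin 1 0 q = q.1.
Proof. by rewrite /lin; ring. Qed.
Lemma lin01 (q : R * R) : lin 0 1 q = q.2.
Proof. by rewrite /lin; ring. Qed.

Definition orbit_lift (q : R * R) := eA q *m (eB q *m z0).

Lemma orbit_liftP q : u q = hopf (orbit_lift q).
Proof.
case: q => x y; rewrite /orbit_lift /eA /eB lin10 lin01 /=.
have [_] := u_act 0 0 y; rewrite add0r uz0 hopf_act => uy.
have [ux _] := u_act 0 y x; move: ux; rewrite add0r uy hopf_act.
exact.
Qed.

Lemma eA_unitary q : eA q \is unitarymx. Proof. exact: expmx_unitary. Qed.
Lemma eB_unitary q : eB q \is unitarymx. Proof. exact: expmx_unitary. Qed.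

Lemma eA0 : eA 0 = 1%:M.
Proof. by rewrite /eA lin10 expmx0. Qed.
Lemma eB0 : eB 0 = 1%:M.
Proof. by rewrite /eB lin01 expmx0. Qed.

Lemma orbit_lift0 : orbit_lift 0 = z0.
Proof. by rewrite /orbit_lift eA0 eB0 !mul1mx. Qed.

Lemma curve_cst v w : is_vderive 0 v (fun=> w) 0.
Proof. exact: is_vderive_cst. Qed.

Lemma eA_derive v w (dw : 'cV[R[i]]_3) X : is_vderive 0 v X dw -> X 0 = w ->
  is_vderive 0 v (fun q => eA q *m X q) (v.1%:C *: (A *m w) + dw).
Proof.
move=> DX X0; rewrite scalemxAl -X0 -[dw]mul1mx -eA0; apply: is_vderive_mulmx => // i j.
by rewrite mxE -lin10; exact: expmx_derive.
Qed.

Lemma eB_derive v w (dw : 'cV[R[i]]_3) X : is_vderive 0 v X dw -> X 0 = w ->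
  is_vderive 0 v (fun q => eB q *m X q) (v.2%:C *: (B *m w) + dw).
Proof.
move=> DX X0; rewrite scalemxAl -X0 -[dw]mul1mx -eB0; apply: is_vderive_mulmx => // i j.
by rewrite mxE -lin01; exact: expmx_derive.
Qed.

Lemma eA_derive_cst w : is_vderive (0 : R * R) ((1, 0) : R * R) (fun q => eA q *m w) (A *m w).
Proof.
have := eA_derive (curve_cst (1, 0) w) erefl.
by rewrite /= scale1r addr0.
Qed.

Lemma eB_derive_cst w : is_vderive (0 : R * R) ((0, 1) : R * R) (fun q => eB q *m w) (B *m w).
Proof.
have := eB_derive (curve_cst (0, 1) w) erefl.
by rewrite /= scale1r addr0.
Qed.

Lemma orbit_lift_derive v :
  is_vderive 0 v orbit_lift (v.1%:C *: (A *m z0) + v.2%:C *: (B *m z0)).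
Proof.
have DB := eB_derive (curve_cst v z0) erefl.
by rewrite addr0 in DB; apply: eA_derive DB _; rewrite eB0 mul1mx.
Qed.

Lemma orbit_lift_local p : local_lift u p orbit_lift.
Proof.
exists setT; first by split; [exact: openT|].
split=> [k|q _]; last first.
  split; last by rewrite orbit_liftP.
  exact: S5_unitary (eA_unitary q) (S5_unitary (eB_unitary q) z0S).
apply: expsum_smooth; rewrite /orbit_lift.
under eq_fun do rewrite mxE; apply: expsum_sum => j; apply: expsum_mul.
  exact: expmx_expsum.
under eq_fun do rewrite mxE; apply: expsum_sum => l; apply: expsum_mul.
  exact: expmx_expsum.
exact: expsum_cst.
Qed.

Hypotheses (u_imm : immersion u) (u_lag : lagrangian u).

(** The derivatives at the origin of [orbit_lift] are [A z0] and [B z0], and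
    [det3_neq0] applies to them. *)
Lemma orbit_frame : det3 z0 (A *m z0) (B *m z0) != 0.
Proof.
have tE v : tangent orbit_lift 0 v =
    v.1%:C *: hproj z0 (A *m z0) + v.2%:C *: hproj z0 (B *m z0).
  by rewrite /tangent (deriveC_val (orbit_lift_derive v)) orbit_lift0 hprojD !hprojZ.
apply: det3_neq0 => //.
  have := u_lag (orbit_lift_local 0) (1, 0) (0, 1).
  by rewrite !tE /= !scale1r !scale0r addr0 add0r.
move=> s t st0; have [_ /(_ _ _ (orbit_lift_local 0) (s, t))] := u_imm.
by rewrite tE => /(_ st0) [-> ->].
Qed.

(** On the line of [w], [e^{xA} e^{sB}] and [e^{sB} e^{xA}] agree up to a phase.
    The derivative at [x = 0] shows that [A e^{sB} w - e^{sB} A w] is a multiple of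
    [e^{sB} w] for every [s]; this multiple vanishes at [s = 0], so that the
    derivative at [s = 0] is a relation between [(AB - BA) w] and [w] alone. *)
Lemma commutator_line w p : S5 w -> hopf w = u p ->
  exists k, (A *m B - B *m A) *m w = k *: w.
Proof.
move=> wS wp.
have swap x s : exists c, eA (x, 0) *m (eB (0, s) *m w) = c *: (eB (0, s) *m (eA (x, 0) *m w)).
  have uA q (z : 'cV_3) : u q = hopf z -> u (q.1 + x, q.2) = hopf (eA (x, 0) *m z).
    by rewrite (u_act q.1 q.2 x).1 -surjective_pairing /eA lin10 => ->; rewrite hopf_act.
  have uB q (z : 'cV_3) : u q = hopf z -> u (q.1, q.2 + s) = hopf (eB (0, s) *m z).
    by rewrite (u_act q.1 q.2 s).2 -surjective_pairing /eB lin01 => ->; rewrite hopf_act.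
  have E1 : u (p.1 + x, p.2 + s) = hopf (eA (x, 0) *m (eB (0, s) *m w)).
    exact: uA (uB _ _ (esym wp)).
  have E2 : u (p.1 + x, p.2 + s) = hopf (eB (0, s) *m (eA (x, 0) *m w)).
    exact: uB (uA _ _ (esym wp)).
  have [c _ E] := hopf_eq (etrans (esym E1) E2).
  by exists c.
have step s : exists k, A *m (eB (0, s) *m w) - eB (0, s) *m (A *m w) = k *: (eB (0, s) *m w).
  have DX := eA_derive_cst (eB (0, s) *m w).
  have DY := is_vderive_mull (eB (0, s)) (eA_derive_cst w).
  have [||k E] := is_vderive_line DX DY.
  - by move=> q; exact: S5_unitary (eB_unitary _) (S5_unitary (eA_unitary q) wS).
  - by move=> q; have := swap q.1 s; rewrite /eA !lin10.
  exists k; move: E; rewrite eA0 !mul1mx herm_unitary ?eB_unitary//.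
  by rewrite wS scale1r => ->; rewrite addrK.
have DX := is_vderive_sub (is_vderive_mull A (eB_derive_cst w)) (eB_derive_cst (A *m w)).
have [||k] := is_vderive_line DX (eB_derive_cst w).
- by move=> q; exact: S5_unitary (eB_unitary q) wS.
- by move=> q; have := step q.2; rewrite /eB !lin01.
rewrite eB0 !mul1mx subrr herm0l scale0r addr0 => E.
by exists k; rewrite mulmxBl -!mulmxA.
Qed.

Lemma commutator_skew : skew_hermitian (A *m B - B *m A).
Proof.
rewrite /skew_hermitian linearB /= !trmx_mul map_mxB !map_mxM sA sB.
by rewrite !mulmxN !mulNmx !opprK opprB.
Qed.

(** The derivative of the eigenvector equation of [C = AB - BA] along [X] is
    [C dX = k z0 + mu dX].  In the Hermitian product with [z0] the terms in [mu]
    cancel, as [C] is skew-Hermitian and [mu] is imaginary, so [k = 0]. *)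
Lemma commutator_tangent mu v X (dX : 'cV[R[i]]_3) : (A *m B - B *m A) *m z0 = mu *: z0 ->
  is_vderive 0 v X dX -> X 0 = z0 ->
  (forall q, S5 (X q) /\ exists p, hopf (X q) = u p) ->
  (A *m B - B *m A) *m dX = mu *: dX.
Proof.
move=> Cz0 DX X0 Xu.
have [||k] := is_vderive_line (is_vderive_mull (A *m B - B *m A) DX) DX.
- by move=> q; have [] := Xu q.
- by move=> q; have [Xq [p Xp]] := Xu q; exact: commutator_line Xq Xp.
rewrite X0 Cz0 hermZl z0S mulr1 => E.
suff k0 : k = 0 by rewrite E k0 scale0r add0r.
have muC : mu^* = - mu.
  have := herm_skew z0 z0 commutator_skew; rewrite Cz0 hermZl hermZr z0S !mulr1.
  by move=> /(congr1 -%R) /esym; rewrite opprK.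
have := congr1 (herm^~ z0) E; rewrite /= (herm_skew _ _ commutator_skew) Cz0.
rewrite hermZr muC mulNr opprK hermDl !hermZl z0S mulr1 => /eqP.
by rewrite eq_sym -subr_eq0 addrK => /eqP.
Qed.

Lemma homogeneous_commute : A *m B = B *m A.
Proof.
have [mu Cz0] := commutator_line z0S (esym uz0).
have CE : A *m B - B *m A = mu%:M.
  apply: (scalar_mx_det3 orbit_frame Cz0).
    apply: (commutator_tangent Cz0 (eA_derive_cst z0)); first by rewrite eA0 mul1mx.
    move=> q; split; first exact: S5_unitary (eA_unitary q) z0S.
    exists (q.1, 0); rewrite orbit_liftP /orbit_lift /eA /eB !lin10 !lin01 /=.
    by rewrite expmx0// mul1mx.
  apply: (commutator_tangent Cz0 (eB_derive_cst z0)); first by rewrite eB0 mul1mx.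
  move=> q; split; first exact: S5_unitary (eB_unitary q) z0S.
  exists (0, q.2); rewrite orbit_liftP /orbit_lift /eA /eB !lin10 !lin01 /=.
  by rewrite expmx0// mul1mx.
have /eqP := congr1 mxtrace CE; rewrite linearB /= mxtrace_mulC subrr mxtrace_scalar.
rewrite eq_sym mulrn_eq0 /= => /eqP mu0.
by apply/eqP; rewrite -subr_eq0 CE mu0 raddf0.
Qed.

End Commutation.

(** * Normal form of homogeneous Lagrangian tori *)

Section Wave.
Context {R : realType}.
Implicit Types (a b r : 'I_3 -> R) (zeta : 'cV[R[i]]_3) (q v : R * R).

Definition wave a b zeta q : 'cV[R[i]]_3 :=
  \col_k (cis (lin (a k) (b k) q) * zeta k 0).

(** Equivalently, [(1, 1, 1)], [a] and [b] span R^3.  This form is stable under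
    subtracting constants from [a] and [b], and serves both to cover the torus and
    to show that a vector orthogonal to all three vanishes. *)
Definition phases_onto a b := forall theta : 'I_3 -> R,
  exists phi x y, forall k, theta k = phi + lin (a k) (b k) (x, y).

(** The matrix of this frame is the product of the diagonal matrix of [zeta], of the
    real matrix with columns [(1, 1, 1)], [a], [b], and of the diagonal matrix of
    [1, i, i]; all three are invertible. *)
Lemma det3_phases_onto a b zeta :
  det3 zeta (diag_mx (\row_k ('i * (a k)%:C)) *m zeta)
    (diag_mx (\row_k ('i * (b k)%:C)) *m zeta) != 0 ->
  (forall k, zeta k 0 != 0) /\ phases_onto a b.
Proof.
pose D := \matrix_(i < 3, j < 3) [:: 1; a i; b i]`_j.
pose e : 'rV[R[i]]_3 := \row_j [:: 1; 'i; 'i]`_j.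
rewrite /det3 (_ : \matrix_(_, _) _ =
  diag_mx zeta^T *m map_mx (real_complex R) D *m diag_mx e); last first.
  apply/matrixP => i j; rewrite (mul_diag_mx zeta^T) mul_mx_diag !mxE.
  by case: j => [[|[|[|//]]]] /= lt3; rewrite ?mul_diag_mx; do ?rewrite mxE /=;
    rewrite ?rmorph1; ring.
rewrite !det_mulmx det_diag det_map_mx !mulf_eq0 !negb_or => /andP[/andP[z0 D0] _].
have Du : D \in unitmx by rewrite unitmxE unitfE; move: D0; rewrite fmorph_eq0.
split=> [k|theta].
  by move/prodf_neq0: z0 => /(_ k isT); rewrite mxE.
have [s sE] : exists s : 'cV[R]_3, D *m s = \col_k theta k.
  by exists (invmx D *m \col_k theta k); rewrite mulKVmx.
exists (s 0 0), (s 1 0), (s 2%:R 0) => k.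
move/colP/(_ k): sE; rewrite !mxE !big_ord_recl big_ord0 !mxE /= addr0 mul1r => <-.
rewrite /lin /=; congr (_ + (_ * s _ _ + _ * s _ _)); exact/val_inj.
Qed.

(** A common shift of the frequencies only moves the lift within the Hopf fibers. *)
Lemma waveB a b (da db : R) zeta q :
  wave a b zeta q =
  cis (lin da db q) *: wave (fun k => a k - da) (fun k => b k - db) zeta q.
Proof.
apply/colP => k; rewrite !mxE mulrA -cisD; congr (cis _ * _).
by rewrite /lin; ring.
Qed.

Lemma phases_ontoB a b (da db : R) : phases_onto a b ->
  phases_onto (fun k => a k - da) (fun k => b k - db).
Proof.
move=> ab theta; have [phi [x [y E]]] := ab theta.
by exists (phi + lin da db (x, y)), x, y => k; rewrite E /lin; ring.
Qed.

Definition modulus zeta k : R := complex.Re `|zeta k 0|.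

Lemma modulusE zeta k : `|zeta k 0| = (modulus zeta k)%:C.
Proof. by rewrite /modulus RRe_real ?normr_real. Qed.

Lemma modulus_sqr zeta k : zeta k 0 * (zeta k 0)^* = (modulus zeta k ^+ 2)%:C.
Proof. by rewrite rmorphXn /= -modulusE; exact/esym/sqr_normc. Qed.

Lemma wave_herm a b zeta q : herm (wave a b zeta q) (wave a b zeta q) =
  (\sum_k modulus zeta k ^+ 2)%:C.
Proof.
rewrite /herm rmorph_sum; apply: eq_bigr => k _ /=.
by rewrite -modulus_sqr !mxE rmorphM /= mulrACA cis_conj mul1r.
Qed.

(** The two vanishing sums make the lift Legendrian. *)
Definition normal_form (u : R * R -> set 'cV[R[i]]_3) M a b zeta :=
  [/\ M \is unitarymx, (forall q, u q = hopf (M *m wave a b zeta q)),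
    (forall k, zeta k 0 != 0) /\ \sum_k modulus zeta k ^+ 2 = 1,
    \sum_k a k * modulus zeta k ^+ 2 = 0 /\ \sum_k b k * modulus zeta k ^+ 2 = 0 &
    phases_onto a b].

Lemma homogeneous_normal_form u : homogeneous_torus u -> lagrangian u ->
  exists M a b zeta, normal_form u M a b zeta.
Proof.
move=> [_ u_imm [A [B [sA sB u_act]]]] u_lag.
have [z0 z0S uz0] : exists2 z0, S5 z0 & u (0, 0) = hopf z0.
  have [/(_ (0, 0))[F [W [_ W0] [_ /(_ _ W0)[FS Fu]]]] _] := u_imm.
  by exists (F (0, 0)).
have AB := homogeneous_commute sA sB u_act z0S uz0 u_imm u_lag.
have [P [a [b [uP AE BE]]]] := skew_codiag sA sB AB.
have uP' : P^t* \is unitarymx by rewrite trmxC_unitary.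
pose zeta := P *m z0.
have zetaS : S5 zeta := S5_unitary uP z0S.
have EA t : expmx (t%:C *: A) = udiag P (\row_k cis (t * a k)).
  by rewrite -(expmx_udiag a t uP) -AE.
have EB t : expmx (t%:C *: B) = udiag P (\row_k cis (t * b k)).
  by rewrite -(expmx_udiag b t uP) -BE.
have uE q : u q = hopf (P^t* *m wave a b zeta q).
  rewrite (orbit_liftP u_act uz0) /orbit_lift lin10 lin01 EA EB.
  rewrite (udiag_mulmx P _ z0) udiag_mulmx.
  congr (hopf (_ *m _)).
  rewrite (mulmxA P) (unitarymxP uP) mul1mx -/zeta.
  apply/colP => k; rewrite !mul_diag_mx !mxE mulrA -cisD.
  by congr (cis _ * _); rewrite /lin; ring.
have PA d : P *m (udiag P d *m z0) = diag_mx d *m zeta.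
  by rewrite udiag_mulmx mulmxA (unitarymxP uP) mul1mx.
have : det3 (P *m z0) (P *m (A *m z0)) (P *m (B *m z0)) != 0.
  rewrite mulmx_det3 mulf_neq0//; last exact: orbit_frame u_act z0S uz0 u_imm u_lag.
  by have := unitarymx_unit uP; rewrite unitmxE unitfE.
have PAz := PA (\row_k ('i * (a k)%:C)); have PBz := PA (\row_k ('i * (b k)%:C)).
rewrite -AE in PAz; rewrite -BE in PBz.
rewrite PAz PBz => /det3_phases_onto[zeta0 ab].
(* The means to subtract, as [sum1] shows that the weights add up to 1. *)
pose da := \sum_k a k * modulus zeta k ^+ 2.
pose db := \sum_k b k * modulus zeta k ^+ 2.
have sum1 : \sum_k modulus zeta k ^+ 2 = 1.
  apply: complexI; rewrite -(wave_herm a b zeta 0) -[RHS]zetaS; congr (herm _ _);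
    by apply/colP => k; rewrite mxE /lin !mulr0 addr0 cis0 mul1r.
exists (P^t*), (fun k => a k - da), (fun k => b k - db), zeta.
split; [exact: uP'| |by split| |exact: phases_ontoB].
  by move=> q; rewrite uE (waveB a b da db) -scalemxAr hopfZ// norm_cis.
by split; under eq_bigr do rewrite mulrBl; rewrite sumrB -mulr_sumr sum1 mulr1 subrr.
Qed.

(** A point of the product of circles has arguments [theta_k] relative to [zeta];
    by [phases_onto] they are those of a point of the orbit up to a common phase,
    which the Hopf map ignores. *)
Lemma normal_form_range u M a b zeta : normal_form u M a b zeta ->
  range u = [set act M (hopf z) | z in torus3 (modulus zeta)].
Proof.
move=> [uM uE [zeta0 _] _ ab]; apply/seteqP; split=> [_ [q _ <-]|_ [z zr <-]].
  exists (wave a b zeta q); last by rewrite hopf_act uE.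
  by move=> k; rewrite mxE normrM norm_cis mul1r modulusE.
have /choice[theta thetaE] k : exists t, z k 0 = cis t * zeta k 0.
  have [|t tE] := @normC1_cis R (z k 0 / zeta k 0).
    by rewrite normrM normfV zr -modulusE divff// normr_eq0.
  by exists t; rewrite -tE divfK.
have [phi [x [y E]]] := ab theta.
exists (x, y) => //; rewrite uE hopf_act.
have -> : z = cis phi *: wave a b zeta (x, y).
  by apply/colP => k; rewrite !mxE mulrA -cisD -E -thetaE.
by rewrite -scalemxAr hopfZ// norm_cis.
Qed.

End Wave.

(** * Three by three determinants *)

Section Det3.
Context {R : realType}.
Implicit Types (z x y : 'cV[R[i]]_3).

Lemma big_ord3 (V : nmodType) (f : 'I_3 -> V) : \sum_k f k = f 0 + f 1 + f 2%:R.
Proof.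
rewrite !big_ord_recl big_ord0 addr0 addrA.
by congr (f _ + f _ + f _); exact/val_inj.
Qed.

Lemma det_mx22 (K : comPzRingType) (A : 'M[K]_2) :
  \det A = A 0 0 * A 1 1 - A 0 1 * A 1 0.
Proof.
rewrite (expand_det_row _ 0) !big_ord_recl big_ord0 /cofactor !det_mx11 !mxE /=.
rewrite addr0 expr0 mul1r expr1 mulN1r mulrN.
by congr (_ * A _ _ - A _ _ * A _ _); exact/val_inj.
Qed.

Lemma det3E z x y : det3 z x y =
  z 0 0 * (x 1 0 * y 2%:R 0 - x 2%:R 0 * y 1 0)
  - z 1 0 * (x 0 0 * y 2%:R 0 - x 2%:R 0 * y 0 0)
  + z 2%:R 0 * (x 0 0 * y 1 0 - x 1 0 * y 0 0).
Proof.
rewrite /det3 (expand_det_col _ 0) big_ord3 !mxE /= /cofactor !det_mx22 !mxE /=.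
have l00 : lift (0 : 'I_3) (0 : 'I_2) = 1 by exact/val_inj.
have l01 : lift (0 : 'I_3) (1 : 'I_2) = 2%:R by exact/val_inj.
have l10 : lift (1 : 'I_3) (0 : 'I_2) = 0 by exact/val_inj.
have l11 : lift (1 : 'I_3) (1 : 'I_2) = 2%:R by exact/val_inj.
have l20 : lift (2%:R : 'I_3) (0 : 'I_2) = 0 by exact/val_inj.
have l21 : lift (2%:R : 'I_3) (1 : 'I_2) = 1 by exact/val_inj.
rewrite l00 l01 l10 l11 l20 l21 /= /bump /=; ring.
Qed.

(** The matrix with these columns is unitary. *)
Lemma det3_orthonormal z x y :
  herm z z = 1 -> herm x x = 1 -> herm y y = 1 ->
  herm x z = 0 -> herm y z = 0 -> herm x y = 0 -> `|det3 z x y| = 1.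
Proof.
move=> z1 x1 y1 xz yz xy; apply/normC1.
have zx : herm z x = 0 by rewrite -herm_conj xz conjC0.
have zy : herm z y = 0 by rewrite -herm_conj yz conjC0.
have yx : herm y x = 0 by rewrite -herm_conj xy conjC0.
rewrite /det3; set S := \matrix_(_, _) _.
have <- : \det (S^t*) = (\det S)^* by rewrite det_map_mx det_tr.
rewrite mulrC -det_mulmx (_ : _ *m _ = 1%:M) ?det1//.
have E (i j : 'I_3) : (S^t* *m S) i j = herm ([:: z; x; y]`_j) ([:: z; x; y]`_i).
  by rewrite mxE; apply: eq_bigr => k _; rewrite !mxE mulrC.
apply/matrixP => i j; rewrite E mxE.
by case: i => [[|[|[|//]]]] /= lti; case: j => [[|[|[|//]]]] /= ltj.
Qed.
End Det3.

(** * The Lagrangian angle of the normal form *)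

Section Angle.
Context {R : realType}.
Variables (u : R * R -> set 'cV[R[i]]_3) (M : 'M[R[i]]_3) (a b : 'I_3 -> R)
  (zeta : 'cV[R[i]]_3).
Hypotheses (u_imm : immersion u) (nf : normal_form u M a b zeta).
Implicit Types (p q v w e : R * R).

Let rho := modulus zeta.
Let l k v := lin (a k) (b k) v.
Let g v w : R := \sum_k l k v * l k w * rho k ^+ 2.

Definition dwave q v : 'cV[R[i]]_3 :=
  \col_k ('i * (lin (a k) (b k) v)%:C * (wave a b zeta q k 0)).

Lemma dwaveE q v k :
  dwave q v k 0 = 'i * (l k v)%:C * wave a b zeta q k 0.
Proof. by rewrite /dwave mxE. Qed.

Let L q := M *m wave a b zeta q.
Let dL q v := M *m dwave q v.

Lemma wave_derive p v : is_vderive p v (wave a b zeta) (dwave p v).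
Proof.
move=> k; under eq_fun do rewrite mxE.
apply: is_cderive_eq.
  exact: is_cderive_mul (is_cderive_cis _ _ _ _) (is_cderive_cst _ _ _).
by rewrite !mxE mulr0 addr0 mulrA.
Qed.

Lemma L_derive p v : is_vderive p v L (dL p v).
Proof. exact: is_vderive_mull (wave_derive p v). Qed.

Lemma wave_entry q k : wave a b zeta q k 0 * (wave a b zeta q k 0)^* = (rho k ^+ 2)%:C.
Proof. by rewrite -modulus_sqr !mxE rmorphM /= mulrACA cis_conj mul1r. Qed.

Lemma L_sphere q : herm (L q) (L q) = 1.
Proof.
have [uM _ [_ r1] _ _] := nf.
by rewrite herm_unitary// wave_herm r1.
Qed.

Lemma L_lift p : local_lift u p L.
Proof.
have [uM uE _ _ _] := nf.
exists setT; first by split; [exact: openT|].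
split=> [k|q _]; last by split; [exact: L_sphere|rewrite uE].
apply: expsum_smooth; rewrite /L.
under eq_fun do rewrite mxE; apply: expsum_sum => j; apply: expsum_mul.
  exact: expsum_cst.
under eq_fun do rewrite mxE; apply: expsum_mul; last exact: expsum_cst.
rewrite (_ : (fun q => _) = (fun q => 1 * cis (lin (a j) (b j) q))).
  exact: expsum_cis.
by apply/funext => q; rewrite mul1r.
Qed.

Lemma lin_mean v : \sum_k l k v * rho k ^+ 2 = 0.
Proof.
have [_ _ _ [a0 b0] _] := nf.
under eq_bigr do rewrite /l /lin mulrDl mulrAC [b _ * _ * _]mulrAC.
by rewrite big_split /= -!mulr_suml a0 b0 !mul0r addr0.
Qed.

Lemma dL_L q v : herm (dL q v) (L q) = 0.
Proof.
have [uM _ _ _ _] := nf.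
rewrite herm_unitary// /herm.
rewrite (eq_bigr (fun k => 'i * (l k v * rho k ^+ 2)%:C)).
  by rewrite -mulr_sumr -rmorph_sum /= lin_mean mulr0.
by move=> k _; rewrite dwaveE -(mulrA ('i * _)) wave_entry (rmorphM _ (l k v)) /= mulrA.
Qed.

Lemma dL_dL q v w : herm (dL q v) (dL q w) = (g v w)%:C.
Proof.
have [uM _ _ _ _] := nf.
rewrite herm_unitary// /herm rmorph_sum; apply: eq_bigr => k _ /=.
rewrite (rmorphM _ (_ * _)) (rmorphM _ (l k v)) /= -(wave_entry q) !dwaveE.
rewrite !rmorphM /= conjCi conj_Creal; last first.
  by apply/complex_realP; exists (l k w).
have ii : 'i * 'i = -1 :> R[i] by rewrite -expr2 sqrCi.
rewrite /l; ring: ii.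
Qed.

Lemma g_form : exists E F G : R, forall v w,
  g v w = v.1 * w.1 * E + (v.1 * w.2 + v.2 * w.1) * F + v.2 * w.2 * G.
Proof.
exists (g (1, 0) (1, 0)), (g (1, 0) (0, 1)), (g (0, 1) (0, 1)) => v w.
rewrite /g !mulr_sumr -!big_split /=; apply: eq_bigr => k _.
by rewrite /l /lin /=; ring.
Qed.

(** As [g] is the induced metric, this is the immersion hypothesis. *)
Lemma g_gt0 v : v <> 0 -> 0 < g v v.
Proof.
move=> v0; rewrite lt_neqAle; apply/andP; split; last first.
  by apply: sumr_ge0 => k _; rewrite -expr2 mulr_ge0// sqr_ge0.
apply/eqP => g0; apply: v0; have [_ /(_ _ _ (L_lift 0) v)] := u_imm; apply.
rewrite /tangent (deriveC_val (L_derive 0 v)) /hproj dL_L scale0r subr0.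
by apply: herm_eq0; rewrite dL_dL -g0.
Qed.

Lemma g_frame : exists e1 e2, [/\ g e1 e1 = 1, g e2 e2 = 1, g e1 e2 = 0 &
  0 < e1.1 * e2.2 - e1.2 * e2.1].
Proof.
have [E [F [G gE]]] := g_form.
have E0 : 0 < E.
  have := @g_gt0 (1, 0); rewrite gE /= !(mulr0, mul0r, addr0, mulr1, mul1r); apply.
  by case=> /eqP; rewrite oner_eq0.
(* Gram-Schmidt on the coordinate vectors: [(- F, E)] is orthogonal to [(1, 0)]. *)
pose N := g (- F, E) (- F, E).
have N0 : 0 < N by apply: g_gt0 => -[_ /eqP]; rewrite gt_eqF.
have sE0 : Num.sqrt E != 0 by rewrite sqrtr_eq0 -ltNge.
have sN0 : Num.sqrt N != 0 by rewrite sqrtr_eq0 -ltNge.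
have EE : Num.sqrt E ^+ 2 = E by rewrite sqr_sqrtr// ltW.
have NN : Num.sqrt N ^+ 2 = N by rewrite sqr_sqrtr// ltW.
exists ((Num.sqrt E)^-1, 0), (- F / Num.sqrt N, E / Num.sqrt N).
rewrite !gE /=; split.
- by rewrite -[X in _ * X + _ + _]EE; field.
- have -> : forall s : R, - F / s * (- F / s) * E + (- F / s * (E / s) + E / s * (- F / s)) * F
     + E / s * (E / s) * G = N * s ^- 2.
    by move=> s; rewrite /N gE /= -exprVn; ring.
  by rewrite NN mulfV// gt_eqF.
- by ring.
- by rewrite mul0r subr0 !mulr_gt0// invr_gt0 sqrtr_gt0.
Qed.

Let Sa := \sum_k a k.
Let Sb := \sum_k b k.
Let K : R[i] := \det M * (zeta 0 0 * zeta 1 0 * zeta 2%:R 0) *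
  det3 (const_mx 1) (\col_k ('i * (a k)%:C)) (\col_k ('i * (b k)%:C)).

(** The product of the coordinates of the lift carries the whole dependence on [q];
    in the frame vectors each coordinate appears as a factor, which leaves a
    constant determinant and the oriented area of [v, w]. *)
Lemma det3_L q v w : det3 (L q) (dL q v) (dL q w) =
  K * cis (lin Sa Sb q) * (v.1 * w.2 - v.2 * w.1)%:C.
Proof.
have lC k e : (l k e)%:C = (a k)%:C * e.1%:C + (b k)%:C * e.2%:C.
  by rewrite /l /lin rmorphD !rmorphM.
have wE k : wave a b zeta q k 0 = cis (l k q) * zeta k 0 by rewrite mxE.
rewrite mulmx_det3 /K /Sa /Sb !big_ord3.
have -> : cis (lin (a 0 + a 1 + a 2%:R) (b 0 + b 1 + b 2%:R) q) =
    cis (l 0 q) * cis (l 1 q) * cis (l 2%:R q).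
  by rewrite -!cisD; congr cis; rewrite /l /lin; ring.
rewrite !det3E !dwaveE !wE !lC rmorphB 2!rmorphM /= !mxE.
ring.
Qed.


Lemma tangent_horizontal F q v : herm (deriveC F q v) (F q) = 0 ->
  tangent F q v = deriveC F q v.
Proof. by move=> h; rewrite /tangent /hproj h scale0r subr0. Qed.

Lemma L_metric q v w : metric L q v w = g v w.
Proof.
have E e : tangent L q e = dL q e.
  by rewrite tangent_horizontal (deriveC_val (L_derive q e)) ?dL_L.
by rewrite /metric !E dL_dL.
Qed.

Lemma L_legendrian p : legendrian_lift u p L.
Proof.
split; first exact: L_lift.
by near=> q => v; rewrite (deriveC_val (L_derive q v)) dL_L.
Unshelve. all: end_near. Qed.

(** Here [det3_L] is [K] times the area of the frame.  For an orthonormal frame it has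
    modulus 1, so it equals [K / |K|], whatever the point. *)
Lemma special_of_balanced : (forall q, lin Sa Sb q = 0) -> special_lagrangian u.
Proof.
move=> S0 p.
(* If [K = 0] there is no orthonormal frame, and any angle will do. *)
have [beta betaE] : exists beta, cis beta = if K == 0 then 1 else K / `|K|.
  have [|t tE] := @normC1_cis R (if K == 0 then 1 else K / `|K|).
    by case: eqP => [_|/eqP K0]; rewrite ?normr1// normrM normfV normr_id divff ?normr_eq0.
  by exists t.
exists (fun=> beta); last by near=> q.
exists L; first exact: L_legendrian.
near=> q; split; first exact: cst_continuous.
move=> e1 e2 [g1 g2 g12 w0]; rewrite !(deriveC_val (L_derive _ _)).
rewrite !L_metric in g1 g2 g12.
have : `|det3 (L q) (dL q e1) (dL q e2)| = 1.
  by apply: det3_orthonormal; rewrite ?dL_L ?L_sphere// dL_dL ?g1 ?g2 ?g12.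
rewrite det3_L S0 cis0 mulr1 normrM.
set w := (e1.1 * _ - _) in w0 *.
rewrite (ger0_norm (_ : 0 <= w%:C)); last by rewrite ler0c ltW.
have [->|K0] := eqVneq K 0; first by rewrite normr0 mul0r => /esym/eqP; rewrite oner_eq0.
move=> Kw; rewrite -/(cis beta) betaE (negbTE K0); congr (_ * _).
by apply: (mulfI (_ : `|K| != 0)); rewrite ?normr_eq0// Kw divff// normr_eq0.
Unshelve. all: end_near. Qed.

(** A Legendrian lift [F] is [c L] for a phase [c], and the Legendrian conditions on
    [F] and [L] force the derivative of [c] to vanish.  So [e^{i beta}] is
    [c^3 k0 e^{i (Sa x + Sb y)}] near the origin; if it is constant there, its
    derivative shows that [Sa] and [Sb] vanish. *)
Lemma balanced_of_special : special_lagrangian u -> forall v, lin Sa Sb v = 0.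
Proof.
move=> /(_ 0)[beta [F [[W [oW W0] [sF FW]] leg] ang] beta0] v.
have [e1 [e2 [g1 g2 g12 w0]]] := g_frame.
have [uM uE _ _ _] := nf.
pose c q := herm (F q) (L q).
have cW q : W q -> F q = c q *: L q /\ c q * (c q)^* = 1.
  move=> Wq; have [FS Fu] := FW _ Wq.
  have [d /normC1 d1 Fd] : exists2 d, `|d| = 1 & F q = d *: L q.
    by apply: hopf_eq; rewrite Fu uE.
  by rewrite /c Fd hermZl L_sphere mulr1.
have dc q e : W q -> (forall e, herm (deriveC F q e) (F q) = 0) ->
    is_cderive q e c 0 /\ deriveC F q e = c q *: dL q e.
  move=> Wq legq; have [Fq cq] := cW q Wq.
  have DF := smoothC_is_deriveV e sF Wq.
  have Lq : L q = (c q)^* *: F q by rewrite Fq scalerA mulrC cq scale1r.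
  have Dc : is_cderive q e c 0.
    apply: is_cderive_eq (is_cderive_herm DF (L_derive q e)) _.
    rewrite {1}Lq hermZr legq mulr0 add0r Fq hermZl -herm_conj dL_L.
    by rewrite conjC0 mulr0.
  split=> //; apply: is_vderive_unique DF _.
  have := is_vderive_scale Dc (L_derive q e); rewrite scale0r add0r.
  apply: is_vderive_near; have := open_nbhs_nbhs (conj oW Wq).
  by apply: filterS => r Wr; rewrite -(cW r Wr).1.
pose k0 := K * (e1.1 * e2.2 - e1.2 * e2.1)%:C.
pose G q := c q * (c q * c q) * (k0 * cis (lin Sa Sb q)).
have GE : \forall q \near (0 : R * R), cis (beta 0) = G q.
  near=> q.
  have Wq : W q by near: q; exact: open_nbhs_nbhs.
  have legq e : herm (deriveC F q e) (F q) = 0 by move: e; near: q.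
  have <- : beta q = beta 0 by near: q.
  have [_ angq] : {for q, continuous beta} /\ forall e1 e2, oriented_orthonormal F q e1 e2 ->
      cos (beta q) +i* sin (beta q) = det3 (F q) (deriveC F q e1) (deriveC F q e2).
    by near: q.
  have [Fq cq] := cW q Wq.
  have dFE e : deriveC F q e = c q *: dL q e by have [] := dc q e Wq legq.
  have mE e e' : metric F q e e' = g e e'.
    rewrite /metric !tangent_horizontal// !dFE hermZl hermZr mulrA cq mul1r.
    by rewrite dL_dL.
  rewrite /cis (angq e1 e2); last by split; rewrite ?mE.
  rewrite !dFE Fq -!mul_scalar_mx mulmx_det3 det_scalar det3_L /G /k0.
  by rewrite !exprS expr0; ring.
(* The derivative of [c] is needed at the origin only: [G] is constant nearby. *)
have W0c e : is_cderive 0 e c 0.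
  have [] // := dc 0 e W0 _.
  by move: (nbhs_singleton leg).
have DG : is_cderive 0 v G (G 0 * ('i * (lin Sa Sb v)%:C)).
  apply: is_cderive_eq.
    apply: is_cderive_mul; first by do 2 apply: is_cderive_mul => //.
    exact: is_cderive_mul (is_cderive_cst _ _ _) (is_cderive_cis _ _ _ _).
  by rewrite /G; ring.
have := is_cderive_unique DG (is_cderive_near GE (is_cderive_cst _ _ _)).
move/eqP; rewrite -(nbhs_singleton GE) !mulf_eq0 (negbTE (cis_neq0 _)) (negbTE (neq0Ci _)) /=.
by move=> /eqP/complexI.
Unshelve. all: end_near. Qed.

(** The vector [s_k = r_k^2 - 1/3] is orthogonal to [(1, 1, 1)], and, when
    [Sa = Sb = 0], also to [a] and [b]; by [phases_onto] it is a combination of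
    these three, so it is orthogonal to itself. *)
Lemma special_lagrangian_iff :
  special_lagrangian u <-> (forall k, rho k = 1 / Num.sqrt 3).
Proof.
have [_ _ [_ r1] [a0 b0] ab] := nf.
have sq3 : (1 / Num.sqrt 3) ^+ 2 = 3^-1 :> R by rewrite exprMn expr1n mul1r exprVn sqr_sqrtr.
split=> [/balanced_of_special S0 k|rhoE].
  have Sa0 : Sa = 0 by have := S0 (1, 0); rewrite /lin /= mulr1 mulr0 addr0.
  have Sb0 : Sb = 0 by have := S0 (0, 1); rewrite /lin /= mulr1 mulr0 add0r.
  pose s j := rho j ^+ 2 - 3^-1.
  have [phi [x [y E]]] := ab s.
  have : \sum_j s j ^+ 2 == 0.
    under eq_bigr => j _ do rewrite expr2 [X in X * _]E /lin mulrDl mulrDl.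
    rewrite 2!big_split /= -mulr_sumr.
    have -> : \sum_j s j = 0 by rewrite sumrB r1 big_ord3; lra.
    have -> : \sum_j a j * x * s j = 0.
      under eq_bigr do rewrite mulrAC mulrBr; rewrite -mulr_suml sumrB a0 -mulr_suml.
      by rewrite -/Sa Sa0; ring.
    have -> : \sum_j b j * y * s j = 0.
      under eq_bigr do rewrite mulrAC mulrBr; rewrite -mulr_suml sumrB b0 -mulr_suml.
      by rewrite -/Sb Sb0; ring.
    by rewrite mulr0 !addr0.
  rewrite psumr_eq0; last by move=> j _; exact: sqr_ge0.
  move=> /allP/(_ k); rewrite mem_index_enum => /(_ isT).
  rewrite /= sqrf_eq0 subr_eq0 -sq3 eqrXn2// => [/eqP//|].
  by rewrite /rho -ler0c -modulusE.
apply: special_of_balanced => q.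
have rho2 k : rho k ^+ 2 = 3^-1 by rewrite rhoE sq3.
have S0 c : \sum_k c k * rho k ^+ 2 = 0 -> \sum_k c k = 0.
  under eq_bigr do rewrite rho2.
  by rewrite -mulr_suml => /eqP; rewrite mulf_eq0 invr_eq0 pnatr_eq0 orbF => /eqP.
by rewrite /lin /Sa /Sb (S0 a)// (S0 b)// !mul0r addr0.
Qed.

End Angle.

(** * Classification *)

Theorem theorem5p1 (R : realType) (u : R * R -> set 'cV[R[i]]_3)
    (u_hom : homogeneous_torus u) (u_lag : lagrangian u)
    (u_stat : hamiltonian_stationary u) :
  exists (M : 'M[R[i]]_3) (r : 'I_3 -> R),
    [/\ M \is unitarymx,
        (forall k, 0 < r k),
        \sum_k r k ^+ 2 = 1,
        range u = [set act M (hopf z) | z in torus3 r] &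
        special_lagrangian u <-> (forall k, r k = 1 / Num.sqrt 3)].
Proof.
have [M [a [b [zeta nf]]]] := homogeneous_normal_form u_hom u_lag.
have [uM _ [zeta0 r1] _ _] := nf.
have [_ u_imm _] := u_hom.
exists M, (modulus zeta); split=> //.
- by move=> k; rewrite -ltcR -modulusE normr_gt0.
- exact: normal_form_range nf.
- exact: special_lagrangian_iff u_imm nf.
Qed.
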